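(* Suppose $C$ has full row rank, $X\succ0$, $(A,B)$ is controllable, and $(C,A)$ and $(Q^{1/2},A)$ are observable. Suppose that the globally optimal controller of the problem $\min_{\mathsf K\in\mathbb{K}}J(\mathsf K)$ (i.e. the minimizer of $J$ over $\mathbb{K}$) exists and is observable, i.e. lies in $\mathbb{K}_o$. Consider the policy gradient iteration $$\mathsf K_{i+1}=\mathsf K_i-\alpha_i\nabla_{\mathsf K_i}J(\mathsf K_i),$$ where the learning rates $\alpha_i>0$ are such that $\mathsf K_i\in\mathbb{K}$ for all $i\ge0$ and $\inf_i\alpha_i>0$. If the iteration converges to an observable stationary point $\mathsf K^\star\in\mathbb{K}_s\cap\mathbb{K}_o$, then $\mathsf K^\star$ is globally optimal, i.e. $J(\mathsf K^\star)\le J(\mathsf K)$ for all $\mathsf K\in\mathbb{K}$.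
   Context: Fix $A\in\mathbb{R}^{n\times n}$, $B\in\mathbb{R}^{n\times m}$, $C\in\mathbb{R}^{d\times n}$, $Q\in\mathbb{R}^{n\times n}$ symmetric positive semidefinite and $R\in\mathbb{R}^{m\times m}$ symmetric positive definite. The system is $x_{t+1}=Ax_t+Bu_t$, $y_t=Cx_t$, controlled by the full-order dynamic controller $\xi_{t+1}=A_{\mathsf K}\xi_t+B_{\mathsf K}y_t$, $u_t=C_{\mathsf K}\xi_t$, with $A_{\mathsf K}\in\mathbb{R}^{n\times n}$, $B_{\mathsf K}\in\mathbb{R}^{n\times d}$, $C_{\mathsf K}\in\mathbb{R}^{m\times n}$. Controller parameters are collected as $\mathsf K=\begin{bmatrix}0_{m\times d}&C_{\mathsf K}\\ B_{\mathsf K}&A_{\mathsf K}\end{bmatrix}$. Put $$\bar A=\begin{bmatrix}A&0\\ 0&0\end{bmatrix},\ \bar B=\begin{bmatrix}B&0\\ 0&I_n\end{bmatrix},\ \bar C=\begin{bmatrix}C&0\\ 0&I_n\end{bmatrix},\ \bar Q=\begin{bmatrix}Q&0\\ 0&0_{n\times n}\end{bmatrix},\ \bar R=\begin{bmatrix}R&0\\ 0&0_{n\times n}\end{bmatrix},$$ so that $\bar A+\bar B\mathsf K\bar C=\begin{bmatrix}A&BC_{\mathsf K}\\ B_{\mathsf K}C&A_{\mathsf K}\end{bmatrix}$ is the closed-loop matrix for $\bar x_t=(x_t,\xi_t)$. $\mathbb{K}$ is the set of $\mathsf K$ of the block form $\begin{bmatrix}0_{m\times d}&C_{\mathsf K}\\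 B_{\mathsf K}&A_{\mathsf K}\end{bmatrix}$ with spectral radius $\rho(\bar A+\bar B\mathsf K\bar C)<1$; $\mathbb{K}_o$ is the set of $\mathsf K$ of this block form with $(C_{\mathsf K},A_{\mathsf K})$ observable. The initial state $\bar x_0=(x_0,\xi_0)$ follows a fixed distribution $\bar{\mathcal D}$ independent of $\mathsf K$, with finite second moments, and $X=\mathbb{E}_{\bar x_0\sim\bar{\mathcal D}}[\bar x_0\bar x_0^{\mathsf T}]$. The dLQR cost on $\mathbb{K}$ is $J(\mathsf K)=\mathbb{E}_{\bar x_0\sim\bar{\mathcal D}}\left[\sum_{t=0}^\infty (x_t^{\mathsf T}Qx_t+u_t^{\mathsf T}Ru_t)\right]=\mathrm{Tr}(P_{\mathsf K}X)$, where $P_{\mathsf K}$ is the unique positive semidefinite solution of $P_{\mathsf K}=\bar Q+\bar C^{\mathsf T}\mathsf K^{\mathsf T}\bar R\mathsf K\bar C+(\bar A+\bar B\mathsf K\bar C)^{\mathsf T}P_{\mathsf K}(\bar A+\bar B\mathsf K\bar C)$. The policy gradient is $\nabla_{\mathsf K}J(\mathsf K)=\begin{bmatrix}0_{m\times d}&\nabla_{C_{\mathsf K}}J(\mathsf K)\\ \nabla_{B_{\mathsf K}}J(\mathsf K)&\nabla_{A_{\mathsf K}}J(\mathsf K)\end{bmatrix}$, and $\mathbb{K}_s$ is the set of stationary points: controllers in $\mathbb{K}$ at which $\nabla_{\mathsf K}J(\mathsf K)=0$. *)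

(* Defs.v *)
From HB Require Import structures.
From mathcomp Require Import all_boot all_order all_algebra.
From mathcomp Require Import complex.
From mathcomp Require Import all_classical all_reals all_analysis.

Set Implicit Arguments.
Unset Strict Implicit.
Unset Printing Implicit Defensive.

Import Order.TTheory GRing.Theory Num.Theory.
Import numFieldNormedType.Exports.

Local Open Scope classical_set_scope.
Local Open Scope ring_scope.
Local Open Scope complex_scope.

Section Matrices.
Context {R : realType}.

Definition quad {n} (M : 'M[R]_n) (x : 'cV[R]_n) : R := (x^T *m M *m x) 0 0.

Definition psdmx {n} (M : 'M[R]_n) : Prop :=
  M^T = M /\ forall x : 'cV[R]_n, 0 <= quad M x.

Definition pdmx {n} (M : 'M[R]_n) : Prop :=
  M^T = M /\ forall x : 'cV[R]_n, x != 0 -> 0 < quad M x.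

(* S = M^{1/2}; for M positive semidefinite such an S exists and is unique. *)
Definition is_psd_sqrt {n} (M S : 'M[R]_n) : Prop := psdmx S /\ S *m S = M.

(* The supremum is over a finite set, which is empty (with sup = 0) only when
   n = 0. *)
Definition spectral_radius {n} (M : 'M[R]_n) : R :=
  sup [set r : R | exists2 z : R[i],
         eigenvalue (map_mx (real_complex R) M) z & `|z| = r%:C].

(* Gradient for the Frobenius inner product, as the matrix of partials. *)
Definition mxgrad {p q} (f : 'M[R]_(p, q) -> R) (M : 'M[R]_(p, q)) :
    'M[R]_(p, q) :=
  \matrix_(i, j) 'D_(delta_mx i j) f M.

End Matrices.

Section LinearSystems.
Context {R : realType}.

Fixpoint lti_state {n m} (A : 'M[R]_n) (B : 'M[R]_(n, m)) (x0 : 'cV[R]_n)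
    (u : nat -> 'cV[R]_m) (t : nat) : 'cV[R]_n :=
  if t is s.+1 then A *m lti_state A B x0 u s + B *m u s else x0.

Definition controllable {n m} (A : 'M[R]_n) (B : 'M[R]_(n, m)) : Prop :=
  forall x0 xf : 'cV[R]_n, exists (T : nat) (u : nat -> 'cV[R]_m),
    lti_state A B x0 u T = xf.

Definition observable {n d} (C : 'M[R]_(d, n)) (A : 'M[R]_n) : Prop :=
  forall x x' : 'cV[R]_n,
    (forall t, C *m iter t (mulmx A) x = C *m iter t (mulmx A) x') -> x = x'.

End LinearSystems.

Section Controllers.
Context {R : realType} {n m d : nat}.
Implicit Types (K : 'M[R]_(m + n, d + n)).

Definition controller (AK : 'M[R]_n) (BK : 'M[R]_(n, d)) (CK : 'M[R]_(m, n)) :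
    'M[R]_(m + n, d + n) :=
  block_mx 0 CK BK AK.

Definition ctrlA K : 'M[R]_n := drsubmx K.
Definition ctrlB K : 'M[R]_(n, d) := dlsubmx K.
Definition ctrlC K : 'M[R]_(m, n) := ursubmx K.

Definition is_controller K : Prop := ulsubmx K = 0.

Definition barA (A : 'M[R]_n) : 'M[R]_(n + n) := block_mx A 0 0 0.
Definition barB (B : 'M[R]_(n, m)) : 'M[R]_(n + n, m + n) :=
  block_mx B 0 0 1%:M.
Definition barC (C : 'M[R]_(d, n)) : 'M[R]_(d + n, n + n) :=
  block_mx C 0 0 1%:M.

Definition closed_loop (A : 'M[R]_n) (B : 'M[R]_(n, m)) (C : 'M[R]_(d, n)) K :
    'M[R]_(n + n) :=
  barA A + barB B *m K *m barC C.

Definition stabilizing (A : 'M[R]_n) (B : 'M[R]_(n, m)) (C : 'M[R]_(d, n)) :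
    set 'M[R]_(m + n, d + n) :=
  [set K | is_controller K /\ spectral_radius (closed_loop A B C K) < 1].

Definition observable_controllers : set 'M[R]_(m + n, d + n) :=
  [set K | is_controller K /\ observable (ctrlC K) (ctrlA K)].

(* The pair (x_t, xi_t) under u_t = CK xi_t, y_t = C x_t. *)
Fixpoint trajectory (A : 'M[R]_n) (B : 'M[R]_(n, m)) (C : 'M[R]_(d, n)) K
    (z : 'cV[R]_(n + n)) (t : nat) : 'cV[R]_n * 'cV[R]_n :=
  if t is s.+1 then
    let: (x, xi) := trajectory A B C K z s in
    let u := ctrlC K *m xi in
    let y := C *m x in
    (A *m x + B *m u, ctrlA K *m xi + ctrlB K *m y)
  else (usubmx z, dsubmx z).

Definition stage_cost (A : 'M[R]_n) (B : 'M[R]_(n, m)) (C : 'M[R]_(d, n))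
    (Q : 'M[R]_n) (W : 'M[R]_m) K (z : 'cV[R]_(n + n)) (t : nat) : R :=
  let: (x, xi) := trajectory A B C K z t in
  quad Q x + quad W (ctrlC K *m xi).

End Controllers.

Section Cost.
Context {R : realType} {n m d : nat}.
Context {disp : measure_display} {Omega : measurableType disp}.
Context (P : probability Omega R).

Definition random_vector {k} (z : 'I_k -> {RV P >-> R}) (w : Omega) :
    'cV[R]_k :=
  \col_i z i w.

Definition second_moment {k} (z : 'I_k -> {RV P >-> R}) : 'M[R]_k :=
  \matrix_(i, j) fine 'E_P[(fun w => z i w * z j w)].

(* The weight on the input is called W, R being the field of reals. The
   expectation is taken in \bar R; it is finite on stabilizing controllers when
   z0 has finite second moments, so that [fine] loses nothing there. *)
Definition cost (A : 'M[R]_n) (B : 'M[R]_(n, m)) (C : 'M[R]_(d, n))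
    (Q : 'M[R]_n) (W : 'M[R]_m) (z0 : 'I_(n + n) -> {RV P >-> R})
    (K : 'M[R]_(m + n, d + n)) : R :=
  fine (\int[P]_w
    (\sum_(0 <= t <oo) (stage_cost A B C Q W K (random_vector z0 w) t)%:E))%E.

(* The block that is structurally zero in a controller is not differentiated. *)
Definition policy_gradient (J : 'M[R]_(m + n, d + n) -> R)
    (K : 'M[R]_(m + n, d + n)) : 'M[R]_(m + n, d + n) :=
  block_mx
    0
    (mxgrad (fun CK => J (controller (ctrlA K) (ctrlB K) CK)) (ctrlC K))
    (mxgrad (fun BK => J (controller (ctrlA K) BK (ctrlC K))) (ctrlB K))
    (mxgrad (fun AK => J (controller AK (ctrlB K) (ctrlC K))) (ctrlA K)).

Definition stationary_points (A : 'M[R]_n) (B : 'M[R]_(n, m))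
    (C : 'M[R]_(d, n)) (J : 'M[R]_(m + n, d + n) -> R) :
    set 'M[R]_(m + n, d + n) :=
  [set K | stabilizing A B C K /\ policy_gradient J K = 0].

Definition globally_optimal (A : 'M[R]_n) (B : 'M[R]_(n, m))
    (C : 'M[R]_(d, n)) (J : 'M[R]_(m + n, d + n) -> R) :
    set 'M[R]_(m + n, d + n) :=
  [set K | stabilizing A B C K /\
     forall K', stabilizing A B C K' -> J K <= J K'].

End Cost.

(* Main.v *)
Require Import Defs.
From HB Require Import structures.
From mathcomp Require Import all_boot all_order all_algebra.
From mathcomp Require Import complex ring lra.
From mathcomp Require Import all_classical all_reals all_analysis.
Set Implicit Arguments.
Unset Strict Implicit.
Unset Printing Implicit Defensive.
Import Order.TTheory GRing.Theory Num.Theory.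
Import numFieldNormedType.Exports.
Local Open Scope classical_set_scope.
Local Open Scope ring_scope.

(** An observable stationary controller is unique, and the observable global
   minimizer is itself stationary because the stabilizing controllers form an
   open set on which the cost is differentiable. Hence Kstar is that minimizer.

   Cost. With M the closed-loop matrix, spectral radius below 1 makes the powers
   of M vanish ([spectral_radius_schur]), so the equations
   P = Y + M^T P M and Sigma = X + M Sigma M^T have unique solutions
   ([stein_exists], [stein_unique]), and the cost is tr(P X) ([cost_trace]).
   If M' is another stable closed loop, with P' and Sigma', then
   tr(P' X) - tr(P X) = tr((Y' - P + M'^T P M') Sigma')
   ([lyapunov_trace_diff]). Along a line of controllers this is explicit in the
   step h except for Sigma', which is within O(h) of Sigma; this gives the
   derivative with a quadratic remainder ([cost_variation]). At a minimizer, and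
   at a zero of the gradient, the derivative vanishes in every direction: those
   are the [stationary_equations].

   Uniqueness. Observability makes P positive definite ([lyapunov_pd]), and X
   positive definite makes Sigma so. Put T = - P22^-1 P21 and
   S = Sigma12 Sigma22^-1. The stationary equations and the two Lyapunov
   equations give T S = 1, and the controller is an observer in the coordinates
   xi = T x, with
   A_K = T (A - B F - L C) T^-1, B_K = T L, C_K = - F T^-1. The Schur
   complement H of P solves the control Riccati equation with gain F; the Schur
   complement D of Sigma solves the filtering Riccati equation, without
   measurement noise, with gain L; and T X12 = X22 fixes the coordinates
   ([stationary_blocks_observer_based]). Both A - B F and A - L C are read off
   from M, hence stable, so each Riccati solution is unique ([riccati_unique]).
   The gains are then unique because W + B^T H B and C D C^T are invertible, the
   latter by the full row rank of C ([observer_based_unique]). *)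

(** * The entrywise 1-norm of a matrix *)

Section EntrywiseNorm.
Context {F : numDomainType}.

(** Submultiplicative for all shapes, invariant under transposition, and defined
   over the complex numbers as well as the reals. *)
Definition mx1norm {p q} (M : 'M[F]_(p, q)) : F := \sum_i \sum_j `|M i j|.

Lemma mx1norm_ge0 {p q} (M : 'M[F]_(p, q)) : 0 <= mx1norm M.
Proof. by apply: sumr_ge0 => i _; apply: sumr_ge0. Qed.

Lemma mx1norm_entry {p q} (M : 'M[F]_(p, q)) i j : `|M i j| <= mx1norm M.
Proof.
rewrite /mx1norm (bigD1 i)//= (bigD1 j)//= -addrA lerDl addr_ge0 ?sumr_ge0//.
by move=> k _; apply: sumr_ge0.
Qed.

Lemma mx1norm_eq0 {p q} (M : 'M[F]_(p, q)) : mx1norm M <= 0 -> M = 0.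
Proof.
move=> M0; apply/matrixP => i j; rewrite mxE; apply/eqP; rewrite -normr_eq0.
by rewrite eq_le normr_ge0 andbT (le_trans (mx1norm_entry M i j)).
Qed.

Lemma mx1norm0 {p q} : mx1norm (0 : 'M[F]_(p, q)) = 0.
Proof. by rewrite /mx1norm big1// => i _; rewrite big1// => j _; rewrite mxE normr0. Qed.

Lemma mx1normD {p q} (M N : 'M[F]_(p, q)) :
  mx1norm (M + N) <= mx1norm M + mx1norm N.
Proof.
rewrite /mx1norm -big_split/=; apply: ler_sum => i _.
by rewrite -big_split/=; apply: ler_sum => j _; rewrite mxE ler_normD.
Qed.

Lemma mx1normZ {p q} a (M : 'M[F]_(p, q)) : mx1norm (a *: M) = `|a| * mx1norm M.
Proof.
rewrite /mx1norm mulr_sumr; apply: eq_bigr => i _; rewrite mulr_sumr.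
by apply: eq_bigr => j _; rewrite mxE normrM.
Qed.

Lemma mx1normT {p q} (M : 'M[F]_(p, q)) : mx1norm M^T = mx1norm M.
Proof.
rewrite /mx1norm exchange_big/=.
by apply: eq_bigr => i _; apply: eq_bigr => j _; rewrite mxE.
Qed.

Lemma mx1normM {p q r} (M : 'M[F]_(p, q)) (N : 'M[F]_(q, r)) :
  mx1norm (M *m N) <= mx1norm M * mx1norm N.
Proof.
rewrite /mx1norm mulr_suml; apply: ler_sum => i _.
apply: (@le_trans _ _ (\sum_j \sum_k `|M i k| * `|N k j|)).
  apply: ler_sum => j _; rewrite mxE; apply: le_trans (ler_norm_sum _ _ _) _.
  by apply: ler_sum => k _; rewrite normrM.
rewrite exchange_big mulr_suml/=; apply: ler_sum => k _.
rewrite -mulr_sumr ler_wpM2l// (bigD1 k)//= lerDl sumr_ge0// => l _.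
exact: sumr_ge0.
Qed.

Lemma mxtrace_norm {p} (M : 'M[F]_p) : `|\tr M| <= mx1norm M.
Proof.
apply: le_trans (ler_norm_sum _ _ _) _; apply: ler_sum => i _.
by rewrite (bigD1 i)//= lerDl sumr_ge0.
Qed.

End EntrywiseNorm.

(** * Spectral radius and powers *)

Lemma exprmx_eigen {F : fieldType} {p} (M : 'M[F]_p) (v : 'rV[F]_p) z t :
  v *m M = z *: v -> v *m M ^+ t = z ^+ t *: v.
Proof.
move=> vM; elim: t => [|t IH]; first by rewrite !expr0 mulmx1 scale1r.
by rewrite exprSr mulmxA IH -scalemxAl vM scalerA -exprSr.
Qed.

Section GeometricDecay.
Context {F : numFieldType}.

Definition geometric_decay (a : nat -> F) : Prop :=
  exists c r, [/\ 0 <= c, 0 <= r < 1 & forall t, a t <= c * r ^+ t].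

(** A scalar recurrence with ratio q keeps the decay of its forcing term, at the
   price of a slower rate. *)
Lemma geometric_decay_recurrence (a b : nat -> F) q :
  0 <= q < 1 -> (forall t, 0 <= a t) -> geometric_decay b ->
  (forall t, a t.+1 <= q * a t + b t) -> geometric_decay a.
Proof.
move=> /andP[q0 q1] a0 [c [r [c0 /andP[r0 r1] br]]] ab.
(* Any rate s with q < s < 1 and r <= s would do. *)
pose s := 1 - (1 - q) * (1 - r) / 2.
have sq : s - q = (1 - q) * (1 + r) / 2 by rewrite /s; field.
have sr : s - r = (1 - r) * (1 + q) / 2 by rewrite /s; field.
have sq0 : 0 < s - q by rewrite sq !mulr_gt0 ?subr_gt0 ?invr_gt0// ltr_wpDr.
have rs : r <= s.
  by rewrite -subr_ge0 sr !mulr_ge0 ?invr_ge0 ?subr_ge0 ?(ltW r1)// addr_ge0.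
have s0 : 0 <= s by exact: le_trans r0 rs.
have c'0 : 0 <= a 0 + c / (s - q) by rewrite addr_ge0// divr_ge0// ltW.
exists (a 0 + c / (s - q)), s; split => //.
  rewrite s0 /s/= -subr_gt0 opprB addrC subrK.
  by rewrite !mulr_gt0 ?subr_gt0 ?invr_gt0.
elim=> [|t IH]; first by rewrite expr0 mulr1 lerDl divr_ge0// ltW.
apply: le_trans (ab t) _.
apply: (@le_trans _ _ (q * ((a 0 + c / (s - q)) * s ^+ t) + c * s ^+ t)).
  rewrite lerD// ?ler_wpM2l//; apply: le_trans (br t) _.
  by rewrite ler_wpM2l// lerXn2r// nnegrE.
rewrite exprS [q * _]mulrA -mulrDl [X in _ <= X]mulrA ler_wpM2r ?exprn_ge0//.
rewrite -subr_ge0.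
have -> : (a 0 + c / (s - q)) * s - (q * (a 0 + c / (s - q)) + c)
    = a 0 * (s - q) by field; rewrite gt_eqF.
by rewrite mulr_ge0// ltW.
Qed.

(** With W the remaining product, M^(t+1) W = z M^t W + M^t (M - z) W, so each
   factor M - z can be removed by [geometric_decay_recurrence]. *)
Lemma geometric_decay_powers {p} (M V : 'M[F]_p) (rs : seq F) q :
    0 <= q < 1 -> (forall z, z \in rs -> `|z| <= q) ->
    geometric_decay
      (fun t => mx1norm (M ^+ t * (\prod_(z <- rs) (M - z%:M) * V))) ->
  geometric_decay (fun t => mx1norm (M ^+ t * V)).
Proof.
move=> q01; have /andP[q0 _] := q01.
elim: rs V => [|z rs IH] V zq; first by rewrite big_nil mul1r.
rewrite big_cons => decay; apply: IH => [w wrs|].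
  by apply: zq; rewrite in_cons wrs orbT.
apply: (geometric_decay_recurrence q01 _ decay) => [t|t]; first exact: mx1norm_ge0.
set W := (\prod_(z <- rs) _ * V).
have -> : M ^+ t.+1 * W = z *: (M ^+ t * W) + M ^+ t * ((M - z%:M) * W).
  rewrite exprSr mulrBl mulrBr -[z%:M * W]/(z%:M *m W) mul_scalar_mx.
  by rewrite -[M ^+ t * (z *: W)]scalemxAr addrC subrK mulrA.
rewrite -[_ * _ * V]mulrA -/W; apply: le_trans (mx1normD _ _) _.
by rewrite mx1normZ lerD2r ler_wpM2r ?mx1norm_ge0 ?zq ?mem_head.
Qed.

End GeometricDecay.

Section Schur.
Context {R : realType}.
Implicit Types (p : nat).
Local Open Scope complex_scope.
Local Notation toC := (real_complex R).

(** Stability in terms of powers, rather than eigenvalues, passes directly to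
   subsystems. *)
Definition schur_stable {p} (M : 'M[R]_p) : Prop :=
  (fun t => mx1norm (M ^+ t)) @ \oo --> (0 : R).

Lemma mx1norm_complex {p q} (M : 'M[R]_(p, q)) :
  mx1norm (map_mx toC M) = (mx1norm M)%:C.
Proof.
rewrite /mx1norm !rmorph_sum; apply: eq_bigr => i _.
rewrite rmorph_sum; apply: eq_bigr => j _.
by rewrite mxE normc_def/= expr0n/= addr0 sqrtr_sqr.
Qed.

Lemma map_mx_expr {p} (M : 'M[R]_p) t :
  map_mx toC (M ^+ t) = map_mx toC M ^+ t.
Proof.
elim: t => [|t IH]; first by rewrite !expr0 map_mx1.
by rewrite !exprS map_mxM IH.
Qed.

Lemma eigenvalue_roots {p} (M : 'M[R]_p) : exists rs : seq R[i],
  char_poly (map_mx toC M) = \prod_(z <- rs) ('X - z%:P) /\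
  (forall z, eigenvalue (map_mx toC M) z = (z \in rs)).
Proof.
have [rs rsE] := closed_field_poly_normal (char_poly (map_mx toC M)).
rewrite (monicP (char_poly_monic _)) scale1r in rsE.
by exists rs; split => // z; rewrite eigenvalue_root_char rsE root_prod_XsubC.
Qed.

(** The spectrum is finite, hence bounded, so that the supremum bounds every
   modulus. *)
Lemma spectral_radius_lt1 {p} (M : 'M[R]_p) :
  (spectral_radius M < 1) <->
  exists q : R, [/\ 0 <= q, q < 1 &
    forall z, eigenvalue (map_mx toC M) z -> `|z| <= q%:C].
Proof.
have [rs [_ rsE]] := eigenvalue_roots M.
pose b : R := \sum_(z <- rs) complex.Re `|z|.
have Re_norm (z : R[i]) : `|z| = (complex.Re `|z|)%:C.
  by rewrite RRe_real// normr_real.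
have Re_ge0 (z : R[i]) : 0 <= complex.Re `|z| by rewrite -ler0c -Re_norm.
split.
- move=> rho1; pose S := [set r : R | exists2 z : R[i],
    eigenvalue (map_mx toC M) z & `|z| = r%:C].
  have ubS : has_ubound S.
    exists b => r [z]; rewrite rsE => zrs zr.
    have -> : r = complex.Re `|z| by rewrite zr.
    by rewrite /b (big_rem z zrs) lerDl; apply: sumr_ge0.
  have rho_ge (z : R[i]) : z \in rs -> complex.Re `|z| <= spectral_radius M.
    by move=> zrs; apply: ub_le_sup => //; exists z; rewrite ?rsE// -Re_norm.
  case: (leP 0 (spectral_radius M)) => rho0.
    exists (spectral_radius M); split => // z.
    by rewrite rsE Re_norm lecR; exact: rho_ge.
  exists 0; split => // z; rewrite rsE => /rho_ge.
  by rewrite Re_norm lecR => /le_trans; apply; exact: ltW.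
- move=> [q [q0 q1 qub]]; apply: le_lt_trans q1; rewrite /spectral_radius.
  set S := [set r | _].
  have [->|/set0P S0] := eqVneq S set0; first by rewrite sup0.
  by apply: ge_sup => // r [z /qub + zr]; rewrite zr lecR.
Qed.

(** Cayley-Hamilton annihilates the product of the factors M - z over the
   eigenvalues, and the factors are then removed one at a time. *)
Lemma spectral_radius_schur {p} (M : 'M[R]_p) :
  spectral_radius M < 1 -> schur_stable M.
Proof.
move=> /spectral_radius_lt1[q [q0 q1 qub]].
have [rs [chiE rsE]] := eigenvalue_roots M.
have [c [r [c0 /andP[r0 r1] decay]]] :
    geometric_decay (fun t => mx1norm (map_mx toC M ^+ t)).
  case: p M qub chiE rsE => [|p] M qub chiE rsE.
    exists 0, 0; split => //; first by rewrite lexx ltr01.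
    by move=> t; rewrite mul0r /mx1norm big_ord0.
  have q01 : 0 <= q%:C < 1 by rewrite lecR ltcR q0.
  have zq z : z \in rs -> `|z| <= q%:C by rewrite -rsE; exact: qub.
  have [|c [r [c0 r01 decay]]] :=
    geometric_decay_powers (M := map_mx toC M) (V := 1) q01 zq; last first.
    exists c, r; split => // t; apply: le_trans (decay t).
    by rewrite [_ * 1]mulmx1.
  exists 0, 0; split => //; first by rewrite lexx ltr01.
  move=> t; rewrite mul0r.
  have -> : \prod_(z <- rs) (map_mx toC M - z%:M) = 0.
    rewrite -[RHS](Cayley_Hamilton (map_mx toC M)) chiE rmorph_prod.
    by apply: eq_bigr => z _; rewrite rmorphB/= horner_mx_X horner_mx_C.
  by rewrite mul0r mulr0 mx1norm0.
have /complex_realP[c' cE] := ger0_real c0.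
have /complex_realP[r' rE] := ger0_real r0.
subst c r; rewrite ler0c in r0; rewrite (ltcR r' 1) in r1.
have {}decay t : mx1norm (M ^+ t) <= c' * r' ^+ t.
  by rewrite -lecR -mx1norm_complex map_mx_expr rmorphM rmorphXn; exact: decay.
apply: (@squeeze_cvgr _ _ _ _ (cst 0) (fun t => c' * r' ^+ t)).
- by apply: nearW => t; rewrite mx1norm_ge0 decay.
- exact: cvg_cst.
- rewrite -[X in _ --> X](mulr0 c').
  by apply: cvgMr; apply: cvg_expr; rewrite ger0_norm.
Qed.

Lemma seq_uniform_lt1 (s : seq R) : (forall x, x \in s -> x < 1) ->
  exists q, [/\ 0 <= q, q < 1 & forall x, x \in s -> x <= q].
Proof.
elim: s => [|y s IH] s1; first by exists 0.
have [|q [q0 q1 qs]] := IH; first by move=> x xs; rewrite s1// in_cons xs orbT.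
exists (Num.max y q); split; first by rewrite le_max q0 orbT.
  by rewrite gt_max q1 s1// mem_head.
move=> x; rewrite in_cons le_max => /predU1P[->|/qs ->]; first by rewrite lexx.
by rewrite orbT.
Qed.

(** An eigenvalue z of modulus at least 1 would give
   |v| <= |z|^N |v| = |v M^N| <= |v| |M^N| < |v|. *)
Lemma spectral_radius_lt1_expr {p} (M : 'M[R]_p) N :
  mx1norm (M ^+ N) < 1 -> spectral_radius M < 1.
Proof.
move=> MN1; apply/spectral_radius_lt1.
have [rs [_ rsE]] := eigenvalue_roots M.
have [|q [q0 q1 qrs]] := @seq_uniform_lt1 [seq complex.Re `|z| | z <- rs].
  move=> _ /mapP[z + ->]; rewrite -rsE => /eigenvalueP[v vM v0].
  rewrite -ltcR (RRe_real (normr_real z)) real_ltNge ?normr_real ?real1//.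
  apply/negP => z1; have := exprmx_eigen N vM => /(congr1 mx1norm).
  rewrite mx1normZ => vMN.
  have v_gt0 : 0 < mx1norm v.
    rewrite lt_neqAle mx1norm_ge0 andbT eq_sym; apply: contra v0 => /eqP v0.
    by apply/eqP/mx1norm_eq0; rewrite v0.
  have : mx1norm v < mx1norm v; last by rewrite ltxx.
  apply: (@le_lt_trans _ _ (mx1norm v * mx1norm (map_mx toC M ^+ N))).
    apply: le_trans (mx1normM _ _); rewrite vMN ler_peMl ?mx1norm_ge0//.
    by rewrite normrX exprn_ege1.
  by rewrite gtr_pMr// -map_mx_expr mx1norm_complex ltcR.
exists q; split => // z; rewrite rsE => zrs.
by rewrite -(RRe_real (normr_real z)) lecR qrs//; apply/mapP; exists z.
Qed.

Lemma schur_stable_expr_lt {p} (M : 'M[R]_p) e :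
  schur_stable M -> 0 < e -> exists N, mx1norm (M ^+ N) < e.
Proof.
move=> /cvgrPdist_lt/[apply] -[N _ /(_ N (leqnn N))].
by rewrite sub0r normrN ger0_norm ?mx1norm_ge0//; exists N.
Qed.

Lemma mx1norm_expr_perturb {p} (M E : 'M[R]_p) t : exists2 c, 0 <= c &
  forall h, `|h| <= 1 -> mx1norm ((M + h *: E) ^+ t - M ^+ t) <= c * `|h|.
Proof.
elim: t => [|t [c c0 IH]].
  by exists 0 => // h _; rewrite !expr0 subrr mx1norm0 mul0r.
pose a := mx1norm M + mx1norm E.
have a0 : 0 <= a by rewrite addr_ge0 ?mx1norm_ge0.
exists (a * c + mx1norm E * mx1norm (M ^+ t)).
  by rewrite addr_ge0 ?mulr_ge0 ?mx1norm_ge0.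
move=> h h1; rewrite !exprS.
have -> : (M + h *: E) * (M + h *: E) ^+ t - M * M ^+ t =
    (M + h *: E) *m ((M + h *: E) ^+ t - M ^+ t) + h *: (E *m M ^+ t).
  rewrite mulmxBr [in X in _ = _ - X + _]mulmxDl -scalemxAl opprD.
  by rewrite -!addrA addNr addr0.
apply: le_trans (mx1normD _ _) _; rewrite mx1normZ mulrDl; apply: lerD.
  rewrite -mulrA; apply: le_trans (mx1normM _ _) _.
  rewrite ler_pM ?mx1norm_ge0 ?IH//; apply: le_trans (mx1normD _ _) _.
  by rewrite lerD2l mx1normZ ler_piMl ?mx1norm_ge0.
by rewrite mulrC ler_wpM2r// mx1normM.
Qed.

(** Some power of M has norm below 1, and that power depends continuously on
   the perturbation. *)
Lemma spectral_radius_perturb {p} (M E : 'M[R]_p) : schur_stable M ->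
  exists2 d, 0 < d & forall h, `|h| < d -> spectral_radius (M + h *: E) < 1.
Proof.
move=> /schur_stable_expr_lt/(_ ltr01)[N MN1].
have [c c0 pert] := mx1norm_expr_perturb M E N.
pose d := (1 - mx1norm (M ^+ N)) / (c + 1).
have c1 : 0 < c + 1 by rewrite ltr_wpDl.
have d0 : 0 < d by rewrite divr_gt0// subr_gt0.
exists (Num.min 1 d); first by rewrite lt_min ltr01.
move=> h; rewrite lt_min => /andP[/ltW h1 hd].
apply: (@spectral_radius_lt1_expr _ _ N).
rewrite -[X in mx1norm X](subrK (M ^+ N)); apply: le_lt_trans (mx1normD _ _) _.
rewrite -ltrBrDr; apply: le_lt_trans (pert h h1) _.
apply: (@le_lt_trans _ _ ((c + 1) * `|h|)); first by rewrite ler_wpM2r// lerDl.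
by rewrite mulrC -ltr_pdivlMr.
Qed.

End Schur.

(** * Stein and Lyapunov equations *)

Section Lyapunov.
Context {R : realType}.

Lemma trmx_expr {p} (M : 'M[R]_p) t : M^T ^+ t = (M ^+ t)^T.
Proof.
elim: t => [|t IH]; first by rewrite !expr0 trmx1.
by rewrite exprS IH exprSr trmx_mul.
Qed.

Lemma schur_stableT {p} (M : 'M[R]_p) : schur_stable M -> schur_stable M^T.
Proof.
rewrite /schur_stable (_ : (fun t => mx1norm (M^T ^+ t)) =
  (fun t => mx1norm (M ^+ t)))//.
by apply/funext => t; rewrite trmx_expr mx1normT.
Qed.

Lemma schur_stable_cvg {p q} (M : 'M[R]_p) (x : 'M[R]_(p, q)) :
  schur_stable M -> (fun t => mx1norm (M ^+ t *m x)) @ \oo --> (0 : R).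
Proof.
move=> Ms; apply: (@squeeze_cvgr _ _ _ _ (cst 0)
  (fun t => mx1norm (M ^+ t) * mx1norm x)); last 2 first.
- exact: cvg_cst.
- by rewrite -[X in _ --> X](mul0r (mx1norm x)); apply: cvgMl.
- by apply: nearW => t; rewrite mx1norm_ge0 mx1normM.
Qed.

(** For reading the stability of A - B F and of A - L C off the closed loop. *)
Lemma schur_stable_read {p q} (M : 'M[R]_p) (N : 'M[R]_q)
    (U : 'M[R]_(q, p)) (V : 'M[R]_(p, q)) :
  (forall t, N ^+ t = U *m M ^+ t *m V) -> schur_stable M -> schur_stable N.
Proof.
move=> NE /(schur_stable_cvg V) MV.
apply: (@squeeze_cvgr _ _ _ _ (cst 0)
  (fun t => mx1norm U * mx1norm (M ^+ t *m V))); last 2 first.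
- exact: cvg_cst.
- by rewrite -[X in _ --> X](mulr0 (mx1norm U)); apply: cvgMr.
- by apply: nearW => t; rewrite mx1norm_ge0 NE -mulmxA mx1normM.
Qed.

Lemma stein_iter {p q} (M : 'M[R]_p) (N : 'M[R]_q) (Y Z : 'M[R]_(p, q)) k :
  Z = Y + M *m Z *m N ->
  Z = \sum_(t < k) M ^+ t *m Y *m N ^+ t + M ^+ k *m Z *m N ^+ k.
Proof.
move=> ZE; elim: k => [|k IH].
  by rewrite big_ord0 add0r !expr0 mul1mx mulmx1.
rewrite big_ord_recr/= {1}IH -addrA; congr (_ + _).
rewrite {1}ZE mulmxDr mulmxDl; congr (_ + _).
by rewrite exprSr exprS !mulmxA.
Qed.

(** Iterating, Z = M^t Z N^t, which tends to 0. *)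
Lemma stein_unique {p q} (M : 'M[R]_p) (N : 'M[R]_q) (Z : 'M[R]_(p, q)) :
  schur_stable M -> schur_stable N -> Z = M *m Z *m N -> Z = 0.
Proof.
move=> Ms Ns ZE; apply: mx1norm_eq0.
have Zt t : mx1norm Z <= mx1norm (M ^+ t *m Z) * mx1norm (N ^+ t).
  rewrite {1}(@stein_iter _ _ M N 0 Z t) ?add0r//.
  by rewrite big1 => [|k _]; rewrite ?mulmx0 ?mul0mx// add0r mx1normM.
have := cvgM (schur_stable_cvg Z Ms) Ns; rewrite mulr0 => /(_ _) lim0.
rewrite -(cvg_lim _ lim0)//; apply: limr_ge; first exact: cvgP lim0.
exact: nearW.
Qed.

(** The linear map sending Z to Z - M Z N is injective by [stein_unique], hence
   bijective. *)
Lemma stein_exists {p q} (M : 'M[R]_p) (N : 'M[R]_q) (Y : 'M[R]_(p, q)) :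
  schur_stable M -> schur_stable N -> exists Z, Z = Y + M *m Z *m N.
Proof.
move=> Ms Ns; pose G := 1%:M - lin_mulmx M *m lin_mulmxr N :> 'M[R]_(p * q).
have GE (Z : 'M[R]_(p, q)) : mxvec Z *m G = mxvec (Z - M *m Z *m N).
  by rewrite mulmxBr mulmx1 mulmxA !mul_vec_lin linearB.
have Gu : G \in unitmx.
  rewrite -row_free_unit -kermx_eq0; apply/rowV0P => v /sub_kermxP.
  rewrite -[v]vec_mxK GE => /(congr1 vec_mx); rewrite mxvecK linear0 => /eqP.
  by rewrite subr_eq0 => /eqP/stein_unique -> //; rewrite linear0.
exists (vec_mx (mxvec Y *m invmx G)).
apply/eqP; rewrite -subr_eq; apply/eqP.
by apply: (can_inj mxvecK); rewrite -GE vec_mxK mulmxKV.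
Qed.

(** Choosing N with |M^N| < 1/2, the tail of [stein_iter] is absorbed in the
   left-hand side. *)
Lemma lyapunov_bound {p} (M : 'M[R]_p) : schur_stable M ->
  exists2 c, 0 <= c & forall Y Z : 'M[R]_p,
    Z = Y + M *m Z *m M^T -> mx1norm Z <= c * mx1norm Y.
Proof.
move=> /schur_stable_expr_lt-/(_ 2^-1)[|N /ltW MN]; first by rewrite invr_gt0.
exists (2 * \sum_(t < N) mx1norm (M ^+ t) * mx1norm (M ^+ t)) => [|Y Z ZE].
  by rewrite mulr_ge0// sumr_ge0// => t _; rewrite mulr_ge0 ?mx1norm_ge0.
have sandwich t (V : 'M[R]_p) : mx1norm (M ^+ t *m V *m M^T ^+ t) <=
    mx1norm (M ^+ t) * mx1norm (M ^+ t) * mx1norm V.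
  rewrite trmx_expr; apply: le_trans (mx1normM _ _) _.
  by rewrite mx1normT mulrAC ler_wpM2r ?mx1norm_ge0 ?mx1normM.
have : mx1norm Z <= (\sum_(t < N) mx1norm (M ^+ t) * mx1norm (M ^+ t)) * mx1norm Y
    + 2^-1 * mx1norm Z.
  rewrite {1}(stein_iter N ZE); apply: le_trans (mx1normD _ _) _; apply: lerD.
    rewrite mulr_suml; elim/big_rec2: _ => [|t x V _ Vx]; first by rewrite mx1norm0.
    by apply: le_trans (mx1normD _ _) _; rewrite lerD.
  apply: le_trans (sandwich _ _) _; rewrite ler_wpM2r ?mx1norm_ge0//.
  apply: le_trans (ler_pM _ _ MN MN) _; rewrite ?mx1norm_ge0//.
  by rewrite ler_piMr// invf_le1// ler1n.
by lra.
Qed.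

End Lyapunov.

(** * Quadratic forms *)

Section QuadraticForms.
Context {R : realType}.

Lemma quadE {p} (M : 'M[R]_p) x : quad M x = \sum_i \sum_j M i j * (x i 0 * x j 0).
Proof.
rewrite /quad -mulmxA mxE; apply: eq_bigr => i _; rewrite !mxE mulr_sumr.
by apply: eq_bigr => j _; rewrite mulrCA.
Qed.

Lemma quadD {p} (M N : 'M[R]_p) x : quad (M + N) x = quad M x + quad N x.
Proof. by rewrite /quad mulmxDr mulmxDl mxE. Qed.

Lemma quad_congr {p q} (M : 'M[R]_p) (N : 'M[R]_(p, q)) x :
  quad (N^T *m M *m N) x = quad M (N *m x).
Proof. by rewrite /quad trmx_mul !mulmxA. Qed.

Lemma quad_norm {p} (M : 'M[R]_p) x :
  `|quad M x| <= mx1norm M * (mx1norm x * mx1norm x).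
Proof.
apply: le_trans (mx1norm_entry _ 0 0) _; apply: le_trans (mx1normM _ _) _.
rewrite mulrA ler_wpM2r ?mx1norm_ge0//; apply: le_trans (mx1normM _ _) _.
by rewrite mx1normT mulrC.
Qed.

Lemma quad1_eq0 {p} (x : 'cV[R]_p) : quad 1%:M x = 0 -> x = 0.
Proof.
rewrite /quad mulmx1 mxE => /eqP; rewrite psumr_eq0; last first.
  by move=> i _; rewrite mxE -expr2 sqr_ge0.
move=> /allP x0; apply/colP => i; have := x0 i (mem_index_enum i).
by rewrite !mxE mulf_eq0 orbb => /eqP.
Qed.

Lemma pdmx_psd {p} (M : 'M[R]_p) : pdmx M -> psdmx M.
Proof.
move=> [MT M0]; split => // x; have [->|/M0/ltW//] := eqVneq x 0.
by rewrite /quad mulmx0 mxE.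
Qed.

Lemma pdmx_eq0 {p} (M : 'M[R]_p) x : pdmx M -> quad M x <= 0 -> x = 0.
Proof.
move=> [_ M0] Mx; apply/eqP; apply: contraTT Mx => /M0.
by rewrite -ltNge.
Qed.

Lemma pdmx_unit {p} (M : 'M[R]_p) : pdmx M -> M \in unitmx.
Proof.
move=> Mpd; rewrite -row_free_unit -kermx_eq0; apply/rowV0P => v /sub_kermxP vM.
apply: trmx_inj; rewrite trmx0; apply: (pdmx_eq0 Mpd).
by rewrite /quad trmxK vM mul0mx mxE.
Qed.

Lemma pdmx_addr {p} (M N : 'M[R]_p) : pdmx M -> psdmx N -> pdmx (M + N).
Proof.
move=> [MT M0] [NT N0]; split; first by rewrite linearD/= MT NT.
by move=> x x0; rewrite quadD ltr_pwDl ?M0.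
Qed.

Lemma pdmx_congr {p q} (M : 'M[R]_p) (N : 'M[R]_(p, q)) : pdmx M ->
  (forall x : 'cV[R]_q, N *m x = 0 -> x = 0) -> pdmx (N^T *m M *m N).
Proof.
move=> [MT M0] Ninj; split; first by rewrite !trmx_mul trmxK MT mulmxA.
move=> x x0; rewrite quad_congr; apply: M0; apply: contra x0 => /eqP/Ninj ->.
exact: eqxx.
Qed.

Lemma psdmx_congr {p q} (M : 'M[R]_p) (N : 'M[R]_(p, q)) : psdmx M ->
  psdmx (N^T *m M *m N).
Proof.
move=> [MT M0]; split; first by rewrite !trmx_mul trmxK MT mulmxA.
by move=> x; rewrite quad_congr.
Qed.

Lemma psd_sqrt_eq0 {p} (Q S : 'M[R]_p) x : is_psd_sqrt Q S -> quad Q x = 0 ->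
  S *m x = 0.
Proof.
move=> [[ST _] <-] Qx; apply: quad1_eq0.
by rewrite -quad_congr mulmx1 ST.
Qed.

Section LyapunovForms.
Context {p : nat} (M Y P : 'M[R]_p).
Hypotheses (Ms : schur_stable M) (PE : P = Y + M^T *m P *m M).

Lemma lyapunov_quad_iter k x : quad P x =
  \sum_(t < k) quad Y (M ^+ t *m x) + quad P (M ^+ k *m x).
Proof.
rewrite {1}(stein_iter k PE) quadD trmx_expr quad_congr; congr (_ + _).
elim: k => [|k IH]; first by rewrite !big_ord0 /quad mulmx0 mul0mx mxE.
by rewrite !big_ord_recr/= quadD IH trmx_expr quad_congr.
Qed.

(** The remainder of [lyapunov_quad_iter] vanishes by stability. *)
Lemma lyapunov_quad_cvg x :
  (fun k => \sum_(t < k) quad Y (M ^+ t *m x)) @ \oo --> quad P x.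
Proof.
rewrite (_ : (fun k => _) = (fun k => quad P x - quad P (M ^+ k *m x))).
  rewrite -[X in _ --> X]subr0; apply: cvgB; first exact: cvg_cst.
  apply/cvgr0Pnorm_lt => e e0; have Mx := schur_stable_cvg x Ms.
  have lim0 : (fun t => mx1norm P * (mx1norm (M ^+ t *m x) * mx1norm (M ^+ t *m x)))
    @ \oo --> (0 : R).
    rewrite -[X in _ --> X](mulr0 (mx1norm P)); apply: cvgMr.
    by rewrite -[X in _ --> X](mulr0 0); apply: cvgM.
  move/cvgr0Pnorm_lt : lim0 => /(_ e e0); apply: filterS => t.
  by apply: le_lt_trans; apply: le_trans (quad_norm _ _) (ler_norm _).
by apply/funext => k; rewrite [in RHS](lyapunov_quad_iter k) addrK.
Qed.

Lemma lyapunov_sym : Y^T = Y -> P^T = P.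
Proof.
move=> YT; apply/eqP; rewrite -subr_eq0; apply/eqP.
apply: (stein_unique (schur_stableT Ms) Ms).
rewrite {1 2}PE linearD/= YT !trmx_mul trmxK mulmxBr mulmxBl !mulmxA.
by rewrite opprD addrACA subrr add0r.
Qed.

Lemma lyapunov_psd : psdmx Y -> psdmx P.
Proof.
move=> [YT Y0]; split; first exact: lyapunov_sym.
move=> x; have lim := @lyapunov_quad_cvg x.
rewrite -(cvg_lim _ lim)//; apply: limr_ge; first exact: cvgP lim.
by apply: nearW => k; apply: sumr_ge0.
Qed.

(** The value of P at x dominates every partial sum of the nonnegative terms. *)
Lemma lyapunov_quad_eq0 x : psdmx Y -> quad P x <= 0 ->
  forall t, quad Y (M ^+ t *m x) = 0.
Proof.
move=> Ypsd Px t; have [_ P0] := lyapunov_psd Ypsd; have [_ Y0] := Ypsd.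
apply/eqP; rewrite eq_le Y0 andbT; apply: le_trans Px.
rewrite (lyapunov_quad_iter t.+1) big_ord_recr/= addrAC lerDr.
by rewrite addr_ge0// sumr_ge0.
Qed.

End LyapunovForms.

End QuadraticForms.

(** * The cost as a trace *)

Section ClosedLoop.
Context {R : realType} {n m d : nat}.
Variables (A : 'M[R]_n) (B : 'M[R]_(n, m)) (C : 'M[R]_(d, n)).
Variables (Q : 'M[R]_n) (W : 'M[R]_m).

Lemma controller_eta (K : 'M[R]_(m + n, d + n)) : is_controller K ->
  K = controller (ctrlA K) (ctrlB K) (ctrlC K).
Proof. by move=> K0; rewrite -[LHS]submxK K0. Qed.

Lemma closed_loop_controller AK BK CK : closed_loop A B C (controller AK BK CK) =
  block_mx A (B *m CK) (BK *m C) AK.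
Proof.
rewrite /closed_loop /barA /barB /barC /controller !mulmx_block !mulmx0 !mul0mx.
by rewrite !mul1mx !mulmx1 add_block_mx !(addr0, add0r, mulmx0, mul0mx).
Qed.

(** The matrix Q-bar + C-bar^T K^T R-bar K C-bar of the Lyapunov equation for
   the cost. *)
Definition stage_weight (CK : 'M[R]_(m, n)) : 'M[R]_(n + n) :=
  block_mx Q 0 0 (CK^T *m W *m CK).

Lemma quad_block_diag {p q} (M : 'M[R]_p) (N : 'M[R]_q) (z : 'cV[R]_(p + q)) :
  quad (block_mx M 0 0 N) z = quad M (usubmx z) + quad N (dsubmx z).
Proof.
rewrite -{1}[z]vsubmxK /quad tr_col_mx mul_row_block mul_row_col.
by rewrite !mulmx0 addr0 add0r mxE.
Qed.

Lemma quad_stage_weight CK z : quad (stage_weight CK) z =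
  quad Q (usubmx z) + quad W (CK *m dsubmx z).
Proof. by rewrite quad_block_diag quad_congr. Qed.

Lemma stage_weight_psd CK : psdmx Q -> pdmx W -> psdmx (stage_weight CK).
Proof.
move=> [QT Q0] /pdmx_psd Wpsd; have [WT W0] := Wpsd; split.
  by rewrite tr_block_mx !trmx0 QT (psdmx_congr CK Wpsd).1.
by move=> z; rewrite quad_stage_weight addr_ge0.
Qed.

Lemma trajectoryE AK BK CK z t : trajectory A B C (controller AK BK CK) z t =
  (usubmx (block_mx A (B *m CK) (BK *m C) AK ^+ t *m z),
   dsubmx (block_mx A (B *m CK) (BK *m C) AK ^+ t *m z)).
Proof.
elim: t => [|t IH]; first by rewrite expr0 mul1mx.
rewrite exprS -mulmxA /= IH /ctrlA /ctrlB /ctrlC /controller.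
rewrite block_mxKur block_mxKdl block_mxKdr.
set y := _ *m z; rewrite -{5 6}[y]vsubmxK mul_block_col col_mxKu col_mxKd.
by rewrite !mulmxA [X in (_, X)]addrC.
Qed.

Lemma stage_costE AK BK CK z t : stage_cost A B C Q W (controller AK BK CK) z t =
  quad (stage_weight CK) (block_mx A (B *m CK) (BK *m C) AK ^+ t *m z).
Proof.
by rewrite /stage_cost trajectoryE quad_stage_weight /ctrlC block_mxKur.
Qed.

Context {disp : measure_display} {Omega : measurableType disp}.
Variables (Pr : probability Omega R).

Lemma expectation_quad {k} (z : 'I_k -> {RV Pr >-> R}) (P : 'M[R]_k) :
  (forall i, (z i : Omega -> R) \in Lfun Pr 2%:E) ->
  (\int[Pr]_w (quad P (random_vector z w))%:E)%E =
  (\sum_i \sum_j P i j * second_moment z i j)%:E.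
Proof.
move=> z2.
have zz i j : (z i : Omega -> R) \* z j \in Lfun Pr 1 by exact: Lfun2_mul_Lfun1.
have zint i j : Pr.-integrable setT
    (fun w => (P i j)%:E * (z i w * z j w)%:E)%E.
  by apply: integrableZl => //; exact/Lfun1_integrable/zz.
transitivity (\int[Pr]_w \sum_i \sum_j (P i j)%:E * (z i w * z j w)%:E)%E.
  apply: eq_integral => w _; rewrite quadE -sumEFin; apply: eq_bigr => i _.
  by rewrite -sumEFin; apply: eq_bigr => j _; rewrite !mxE.
rewrite integral_sum//; last by move=> i; exact: integrable_sum.
rewrite -sumEFin; apply: eq_bigr => i _; rewrite integral_sum// -sumEFin.
apply: eq_bigr => j _; rewrite integralZl//; last exact/Lfun1_integrable/zz.
rewrite mxE EFinM fineK; last exact/expectation_fin_num/zz.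
by rewrite unlock.
Qed.

(** The stage costs along a trajectory sum to the quadratic form of P at its
   initial state, whose expectation involves only second moments. *)
Lemma cost_trace (z0 : 'I_(n + n) -> {RV Pr >-> R}) AK BK CK (P : 'M[R]_(n + n)) :
    let M := block_mx A (B *m CK) (BK *m C) AK in
    (forall i, (z0 i : Omega -> R) \in Lfun Pr 2%:E) ->
    (second_moment z0)^T = second_moment z0 ->
    schur_stable M -> P = stage_weight CK + M^T *m P *m M ->
  cost A B C Q W z0 (controller AK BK CK) = \tr (P *m second_moment z0).
Proof.
move=> M z2 XT Ms PE; rewrite /cost.
transitivity (fine (\int[Pr]_w (quad P (random_vector z0 w))%:E)%E).
  congr fine; apply: eq_integral => w _; apply/cvg_lim => //.
  rewrite (_ : (fun k => _) = EFin \o (fun k =>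
    \sum_(t < k) quad (stage_weight CK) (M ^+ t *m random_vector z0 w))).
    by apply: cvg_EFin; [exact: nearW|exact: (@lyapunov_quad_cvg _ _ _ _ _ Ms PE)].
  apply/funext => k /=; rewrite big_mkord -sumEFin.
  by apply: eq_bigr => t _; rewrite stage_costE.
rewrite expectation_quad//=; apply: eq_bigr => i _; rewrite mxE.
by apply: eq_bigr => j _; rewrite -[in RHS]XT [in RHS]mxE.
Qed.

End ClosedLoop.

(** * First variation of the cost *)

Section FirstVariation.
Context {R : realType}.

Lemma addmxE {p q} (M N : 'M[R]_(p, q)) i j : (M + N) i j = M i j + N i j.
Proof. exact: mxE. Qed.

Lemma oppmxE {p q} (M : 'M[R]_(p, q)) i j : (- M) i j = - M i j.
Proof. exact: mxE. Qed.

Lemma scalemxE {p q} a (M : 'M[R]_(p, q)) i j : (a *: M) i j = a * M i j.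
Proof. exact: mxE. Qed.

(** Reduces an identity between linear combinations of matrices to [ring],
   leaving matrix products as atoms. *)
Definition mx_linE := (@addmxE, @oppmxE, @scalemxE).

(** Testing P' - P against X = S' - N S' N^T moves N to the other side, where
   the equation of P' eliminates P'. *)
Lemma lyapunov_trace_diff {p} (N Y' P P' X S' M Y : 'M[R]_p) :
    P = Y + M^T *m P *m M ->
    P' = Y' + N^T *m P' *m N -> S' = X + N *m S' *m N^T ->
  \tr (P' *m X) - \tr (P *m X) =
  \tr ((Y' - Y + (N^T *m P *m N - M^T *m P *m M)) *m S').
Proof.
move=> PE P'E S'E; rewrite -linearB/= -mulmxBl.
have swap (V : 'M[R]_p) : \tr (V *m (N *m S' *m N^T)) = \tr (N^T *m V *m N *m S').
  by rewrite mulmxA mxtrace_mulC !mulmxA.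
have -> : X = S' - N *m S' *m N^T by rewrite {1}S'E addrK.
rewrite mulmxBr linearB/= swap -linearB/= -mulmxBl; congr (\tr (_ *m _)).
rewrite mulmxBr mulmxBl {1}P'E {1}PE.
by apply/matrixP => i j; rewrite !mx_linE; ring.
Qed.

(** The trace difference is h tr(D1 S') + h^2 tr(D2 S'), where S' solves the
   perturbed equation. Seen as an equation for M, that one bounds S' and S' - S
   through [lyapunov_bound], the latter by a multiple of h. *)
Lemma lyapunov_trace_variation {p} (M E P S Y Y1 Y2 X : 'M[R]_p) :
    schur_stable M -> P = Y + M^T *m P *m M -> S = X + M *m S *m M^T ->
  exists d c : R, 0 < d /\ forall h, `|h| < d ->
    spectral_radius (M + h *: E) < 1 /\
    forall P', P' = (Y + h *: Y1 + h ^+ 2 *: Y2) +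
                    (M + h *: E)^T *m P' *m (M + h *: E) ->
      `|\tr (P' *m X) - \tr (P *m X) -
        h * \tr ((Y1 + E^T *m P *m M + M^T *m P *m E) *m S)| <= c * h ^+ 2.
Proof.
move=> Ms PE SE; have [d1 d1_gt0 stab] := spectral_radius_perturb E Ms.
have [c0 c0_ge0 bound] := lyapunov_bound Ms.
pose k := mx1norm E * mx1norm M + mx1norm M * mx1norm E + mx1norm E * mx1norm E.
have k0 : 0 <= k by rewrite !addr_ge0 ?mulr_ge0 ?mx1norm_ge0.
have ck0 : 0 < c0 * k * 2 + 1 by rewrite ltr_wpDl// !mulr_ge0.
pose s := 2 * c0 * mx1norm X.
have s0 : 0 <= s by rewrite !mulr_ge0 ?mx1norm_ge0.
pose D1 := Y1 + E^T *m P *m M + M^T *m P *m E.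
pose D2 := Y2 + E^T *m P *m E.
(* The last bound makes c0 |h| k at most 1/2, so that S' is absorbed. *)
exists (Num.min d1 (Num.min 1 (c0 * k * 2 + 1)^-1)).
exists (mx1norm D1 * (c0 * k * s) + mx1norm D2 * s); split.
  by rewrite !lt_min d1_gt0 ltr01 invr_gt0.
move=> h; rewrite !lt_min => /and3P[hd1 /ltW h1 hk]; split; first exact: stab.
move=> P' P'E; have /spectral_radius_schur Ms' := stab h hd1.
have [S' S'E] := stein_exists X Ms' (schur_stableT Ms').
(* V is the defect of S' in the unperturbed equation. *)
pose V := (M + h *: E) *m S' *m (M + h *: E)^T - M *m S' *m M^T.
have VE : V = h *: (E *m S' *m M^T + M *m S' *m E^T + h *: (E *m S' *m E^T)).
  rewrite /V linearD/= linearZ/= !mulmxDl !mulmxDr -!scalemxAl -!scalemxAr.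
  rewrite -?scalemxAl -?scalemxAr.
  by apply/matrixP => i j; rewrite !mx_linE; ring.
have V_le : mx1norm V <= `|h| * (k * mx1norm S').
  rewrite VE mx1normZ ler_wpM2l//; apply: le_trans (mx1normD _ _) _.
  have three (F G : 'M[R]_p) :
      mx1norm (F *m S' *m G) <= mx1norm F * mx1norm G * mx1norm S'.
    apply: le_trans (mx1normM _ _) _.
    by rewrite mulrAC ler_wpM2r ?mx1norm_ge0 ?mx1normM.
  rewrite !mulrDl; apply: lerD.
    apply: le_trans (mx1normD _ _) _; apply: lerD.
      by apply: le_trans (three _ _) _; rewrite mx1normT.
    by apply: le_trans (three _ _) _; rewrite mx1normT.
  rewrite mx1normZ; apply: le_trans (ler_piMl (mx1norm_ge0 _) h1) _.
  by apply: le_trans (three _ _) _; rewrite mx1normT.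
have S'V : S' = (X + V) + M *m S' *m M^T by rewrite -addrA subrK -S'E.
have hck : `|h| * (c0 * k * 2 + 1) <= 1.
  by rewrite -ler_pdivlMr// mul1r ltW.
have S'_le : mx1norm S' <= s.
  have := bound _ _ S'V => S'b.
  have {}S'b : mx1norm S' <= c0 * (mx1norm X + `|h| * (k * mx1norm S')).
    apply: le_trans S'b _; rewrite ler_wpM2l//.
    by apply: le_trans (mx1normD _ _) _; rewrite lerD2l.
  have : `|h| * (c0 * k * 2 + 1) * mx1norm S' <= mx1norm S'.
    by rewrite ler_piMl ?mx1norm_ge0.
  have : 0 <= `|h| * mx1norm S' by rewrite mulr_ge0 ?mx1norm_ge0.
  by rewrite /s; lra.
have dS_le : mx1norm (S' - S) <= `|h| * (c0 * k * s).
  have /bound : S' - S = V + M *m (S' - S) *m M^T.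
    rewrite mulmxBr mulmxBl addrA subrK {1}S'E {1}SE opprD addrACA subrr add0r.
    by [].
  move/le_trans; apply; rewrite -mulrA mulrCA ler_wpM2l//.
  by apply: le_trans V_le _; rewrite ler_wpM2l// ler_wpM2l.
rewrite (lyapunov_trace_diff PE P'E S'E).
have -> : Y + h *: Y1 + h ^+ 2 *: Y2 - Y +
    ((M + h *: E)^T *m P *m (M + h *: E) - M^T *m P *m M) =
    h *: D1 + h ^+ 2 *: D2.
  rewrite [(M + _)^T]linearD/= [(h *: E)^T]linearZ/= !mulmxDl !mulmxDr.
  rewrite -!scalemxAl -!scalemxAr /D1 /D2.
  by apply/matrixP => i j; rewrite !mx_linE; ring.
have -> : \tr ((h *: D1 + h ^+ 2 *: D2) *m S') - h * \tr (D1 *m S) =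
    h * \tr (D1 *m (S' - S)) + h ^+ 2 * \tr (D2 *m S').
  by rewrite mulmxDl mulmxBr linearB/= -!scalemxAl mxtraceD !mxtraceZ; ring.
apply: le_trans (ler_normD _ _) _; rewrite mulrDl; apply: lerD.
  have -> : mx1norm D1 * (c0 * k * s) * h ^+ 2 =
      `|h| * (mx1norm D1 * (`|h| * (c0 * k * s))).
    by rewrite -[h ^+ 2]real_normK ?num_real//; ring.
  rewrite normrM ler_wpM2l//; apply: le_trans (mxtrace_norm _) _.
  by apply: le_trans (mx1normM _ _) _; rewrite ler_wpM2l ?mx1norm_ge0.
rewrite normrM normrX real_normK ?num_real// mulrC ler_wpM2r ?sqr_ge0//.
apply: le_trans (mxtrace_norm _) _; apply: le_trans (mx1normM _ _) _.
by rewrite ler_wpM2l ?mx1norm_ge0.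
Qed.

End FirstVariation.

(** * Stationary controllers *)

Section Stationarity.
Context {R : realType}.

Lemma quadratic_variation_derive {p q} (F : 'M[R]_(p, q) -> R) x v g d c :
    0 < d -> (forall h, `|h| < d -> `|F (x + h *: v) - F x - h * g| <= c * h ^+ 2) ->
  'D_v F x = g.
Proof.
move=> d0 Fd; apply: cvg_lim => //; apply/cvgrPdist_le => e e0.
have c0 : 0 < `|c| + 1 by rewrite ltr_wpDl.
near=> h.
have h0 : h != 0 by near: h; exact: nbhs_dnbhs_neq.
have hd : `|h| < d by near: h; exact: dnbhs0_lt.
have he : `|h| < e / (`|c| + 1) by near: h; apply: dnbhs0_lt; rewrite divr_gt0.
rewrite ltr_pdivlMr// in he.
have -> : g - h^-1 *: (F (h *: v + x) - F x) =
    - (h^-1 * (F (x + h *: v) - F x - h * g)).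
  by rewrite [x + _]addrC -[_ *: _]/(_ * _); field.
rewrite normrN normrM normfV ler_pdivrMl ?normr_gt0//.
apply: le_trans (Fd h hd) _; rewrite -[h ^+ 2]real_normK ?num_real//.
have : c <= `|c| by exact: ler_norm.
have : 0 <= `|h| by [].
by nra.
Unshelve. all: by end_near.
Qed.

(** Test with h = - t g for a small t > 0. *)
Lemma quadratic_variation_min (f : R -> R) a g d c : 0 < d ->
    (forall h, `|h| < d -> a <= f h) ->
    (forall h, `|h| < d -> `|f h - a - h * g| <= c * h ^+ 2) ->
  g = 0.
Proof.
move=> d0 fmin fd; apply/eqP; apply: contraT => g0.
have g2 : 0 < `|g| by rewrite normr_gt0.
have c0 : 0 < `|c| + 1 by rewrite ltr_wpDl.
pose t := Num.min (d / (2 * `|g|)) (2^-1 / (`|c| + 1)).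
have t0 : 0 < t by rewrite lt_min !divr_gt0 ?mulr_gt0.
have td : t * `|g| < d.
  rewrite -ltr_pdivlMr// /t gt_min; apply/orP; left.
  rewrite ltr_pM2l// ltf_pV2 ?posrE ?mulr_gt0//; lra.
have tc : t * (`|c| + 1) <= 2^-1 by rewrite -ler_pdivlMr// /t ge_min lexx orbT.
have hd : `|- (t * g)| < d by rewrite normrN normrM (gtr0_norm t0).
have := fd _ hd; have := fmin _ hd; set y := f _ => ya.
rewrite ler_norml => /andP[_ yub].
have gg : 0 < g ^+ 2 by rewrite exprn_even_gt0.
have cle : c <= `|c| by exact: ler_norm.
have tgg : 0 < t * g ^+ 2 by rewrite mulr_gt0.
have : t * g ^+ 2 <= (t * g ^+ 2) * (c * t).
  by rewrite -subr_ge0; move: ya yub; rewrite -subr_ge0; lra.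
rewrite ler_pMr// => ct1.
have : c * t <= t * (`|c| + 1) by rewrite mulrC ler_wpM2l ?ltW//; lra.
lra.
Qed.

Lemma mxtrace_delta {p q} (G : 'M[R]_(p, q)) i j :
  \tr ((delta_mx i j)^T *m G) = G i j.
Proof.
rewrite trmx_delta /mxtrace (bigD1 j)//= big1 => [|k kj]; last first.
  by rewrite mxE big1// => l _; rewrite mxE (negbTE kj) mul0r.
rewrite addr0 mxE (bigD1 i)//= big1 => [|k ki]; last first.
  by rewrite mxE (negbTE ki) andbF mul0r.
by rewrite mxE !eqxx mul1r addr0.
Qed.

Section CostVariation.
Context {n m d : nat}.
Variables (A : 'M[R]_n) (B : 'M[R]_(n, m)) (C : 'M[R]_(d, n)).
Variables (Q : 'M[R]_n) (W : 'M[R]_m).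
Hypotheses (Qpsd : psdmx Q) (Wpd : pdmx W).
Context {disp : measure_display} {Omega : measurableType disp}.
Variables (Pr : probability Omega R) (z0 : 'I_(n + n) -> {RV Pr >-> R}).
Hypotheses (z2 : forall i, (z0 i : Omega -> R) \in Lfun Pr 2%:E).
Hypothesis (Xpd : pdmx (second_moment z0)).
Local Notation X := (second_moment z0).
Local Notation J := (cost A B C Q W z0).

Section Controller.
Variables (AK : 'M[R]_n) (BK : 'M[R]_(n, d)) (CK : 'M[R]_(m, n)).
Variables (P S : 'M[R]_(n + n)).
Local Notation M := (block_mx A (B *m CK) (BK *m C) AK).
Hypothesis Ms : schur_stable M.
Hypothesis PE : P = stage_weight Q W CK + M^T *m P *m M.
Hypothesis SE : S = X + M *m S *m M^T.
Local Notation N := (P *m M *m S).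

(** The derivative of the cost in the direction (EA, EB, EC). *)
Definition cost_slope (EA : 'M[R]_n) (EB : 'M[R]_(n, d)) (EC : 'M[R]_(m, n)) : R :=
  2 * (\tr (EA^T *m drsubmx N) + \tr (EB^T *m (dlsubmx N *m C^T)) +
       \tr (EC^T *m (B^T *m ursubmx N + W *m CK *m drsubmx S))).

Lemma block_perturb EA EB EC h :
  block_mx A (B *m (CK + h *: EC)) ((BK + h *: EB) *m C) (AK + h *: EA) =
  M + h *: block_mx 0 (B *m EC) (EB *m C) EA.
Proof.
rewrite scale_block_mx add_block_mx scaler0 addr0.
by rewrite mulmxDr mulmxDl -scalemxAl -scalemxAr.
Qed.

Lemma stage_weight_perturb EC h : stage_weight Q W (CK + h *: EC) =
  stage_weight Q W CK +
  h *: block_mx 0 0 0 (EC^T *m W *m CK + CK^T *m W *m EC) +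
  h ^+ 2 *: block_mx 0 0 0 (EC^T *m W *m EC).
Proof.
rewrite /stage_weight !scale_block_mx !add_block_mx !scaler0 !addr0.
congr block_mx.
rewrite [(CK + _)^T]linearD/= [(h *: EC)^T]linearZ/= !mulmxDl !mulmxDr.
rewrite -!scalemxAl -!scalemxAr.
by apply/matrixP => i j; rewrite !mx_linE; ring.
Qed.

(** The two cross terms are transposes of each other, hence the factor 2. *)
Lemma cost_slopeE EA EB EC : let E := block_mx 0 (B *m EC) (EB *m C) EA in
  \tr ((block_mx 0 0 0 (EC^T *m W *m CK + CK^T *m W *m EC) +
        E^T *m P *m M + M^T *m P *m E) *m S) = cost_slope EA EB EC.
Proof.
move=> E; have [WT _] := Wpd.
have PT : P^T = P by exact: lyapunov_sym Ms PE (stage_weight_psd _ Qpsd Wpd).1.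
have ST : S^T = S.
  apply: (@lyapunov_sym _ _ M^T X) Xpd.1; first exact: schur_stableT.
  by rewrite trmxK.
have -> : block_mx 0 0 0 (EC^T *m W *m CK + CK^T *m W *m EC) +
    E^T *m P *m M + M^T *m P *m E =
    (block_mx 0 0 0 (EC^T *m W *m CK) + E^T *m P *m M) +
    (block_mx 0 0 0 (EC^T *m W *m CK) + E^T *m P *m M)^T.
  rewrite [(_ + _)^T]linearD/= [(block_mx 0 0 0 _)^T]tr_block_mx !trmx0.
  rewrite !trmx_mul !trmxK WT PT !mulmxA.
  rewrite (_ : block_mx 0 0 0 (_ + _) = block_mx 0 0 0 (EC^T *m W *m CK) +
    block_mx 0 0 0 (CK^T *m W *m EC)); last by rewrite add_block_mx !addr0.
  by apply/matrixP => i j; rewrite !mx_linE; ring.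
set D := _ + E^T *m P *m M.
have -> : \tr ((D + D^T) *m S) = 2 * \tr (D *m S).
  rewrite mulmxDl linearD/= -[\tr (D^T *m S)]mxtrace_tr trmx_mul trmxK ST.
  by rewrite [\tr (S *m D)]mxtrace_mulC; ring.
congr (2 * _); rewrite /D mulmxDl linearD/=.
have -> : E^T *m P *m M *m S = E^T *m N by rewrite !mulmxA.
rewrite -{1}[S]submxK mulmx_block !mul0mx !add0r mxtrace_block mxtrace0 add0r.
rewrite -{1}[N]submxK /E tr_block_mx trmx0 mulmx_block mxtrace_block.
rewrite !mul0mx !add0r !trmx_mul linearD/= mulmxDr linearD/=.
rewrite -[C^T *m _ *m _]mulmxA [\tr (C^T *m _)]mxtrace_mulC !mulmxA.
by ring.
Qed.

Lemma cost_variation EA EB EC : exists del c : R, 0 < del /\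
  forall h, `|h| < del ->
    let K' := controller (AK + h *: EA) (BK + h *: EB) (CK + h *: EC) in
    stabilizing A B C K' /\
    `|J K' - J (controller AK BK CK) - h * cost_slope EA EB EC| <= c * h ^+ 2.
Proof.
have [del [c [del0 var]]] := lyapunov_trace_variation
  (block_mx 0 (B *m EC) (EB *m C) EA)
  (block_mx 0 0 0 (EC^T *m W *m CK + CK^T *m W *m EC))
  (block_mx 0 0 0 (EC^T *m W *m EC)) Ms PE SE.
exists del, c; split => // h hdel K'; have [stab {}var] := var h hdel.
rewrite -block_perturb in stab var.
split.
  split; first by rewrite /is_controller block_mxKul.
  by rewrite closed_loop_controller.
have Ms' := spectral_radius_schur stab.
have [P' P'E] :=
  stein_exists (stage_weight Q W (CK + h *: EC)) (schur_stableT Ms') Ms'.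
rewrite (cost_trace z2 Xpd.1 Ms' P'E) (cost_trace z2 Xpd.1 Ms PE).
by rewrite -cost_slopeE; apply: var; rewrite -stage_weight_perturb.
Qed.

(** The three free blocks of the gradient, up to a factor 2. *)
Definition stationary_equations : Prop :=
  [/\ drsubmx N = 0, dlsubmx N *m C^T = 0 &
      B^T *m ursubmx N + W *m CK *m drsubmx S = 0].

Lemma stationary_equations_slope :
    (forall i j, cost_slope (delta_mx i j) 0 0 = 0) ->
    (forall i j, cost_slope 0 (delta_mx i j) 0 = 0) ->
    (forall i j, cost_slope 0 0 (delta_mx i j) = 0) ->
  stationary_equations.
Proof.
rewrite /cost_slope => slopeA slopeB slopeC.
split; apply/matrixP => i j.
- have /eqP := slopeA i j.
  rewrite mulf_eq0 pnatr_eq0/= !trmx0 !mul0mx !mxtrace0 !addr0 mxtrace_delta.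
  by move/eqP => ->; rewrite mxE.
- have /eqP := slopeB i j.
  rewrite mulf_eq0 pnatr_eq0/= !trmx0 !mul0mx !mxtrace0 addr0 add0r.
  by rewrite mxtrace_delta => /eqP ->; rewrite mxE.
- have /eqP := slopeC i j.
  rewrite mulf_eq0 pnatr_eq0/= !trmx0 !mul0mx !mxtrace0 !add0r mxtrace_delta.
  by move/eqP => ->; rewrite mxE.
Qed.

Lemma stationary_equations_optimal :
  globally_optimal A B C J (controller AK BK CK) -> stationary_equations.
Proof.
move=> [_ opt].
suff slope0 EA EB EC : cost_slope EA EB EC = 0.
  by apply: stationary_equations_slope.
have [del [c [del0 var]]] := cost_variation EA EB EC.
apply: (quadratic_variation_min (a := J (controller AK BK CK)) del0) => h hdel.
  by apply: opt; exact: (var h hdel).1.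
exact: (var h hdel).2.
Qed.

Lemma stationary_equations_gradient :
  policy_gradient J (controller AK BK CK) = 0 -> stationary_equations.
Proof.
rewrite /policy_gradient /ctrlA /ctrlB /ctrlC block_mxKdr block_mxKdl block_mxKur.
move=> /eqP; rewrite block_mx_eq0 => /and4P[_ /eqP gC /eqP gB /eqP gA].
apply: stationary_equations_slope => i j.
- have [del [c [del0 var]]] := cost_variation (delta_mx i j) 0 0.
  move/matrixP/(_ i j): gA; rewrite !mxE => <-; apply/esym.
  apply: (quadratic_variation_derive (c := c) del0) => h /var[_].
  by rewrite !scaler0 !addr0.
- have [del [c [del0 var]]] := cost_variation 0 (delta_mx i j) 0.
  move/matrixP/(_ i j): gB; rewrite !mxE => <-; apply/esym.
  apply: (quadratic_variation_derive (c := c) del0) => h /var[_].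
  by rewrite !scaler0 !addr0.
- have [del [c [del0 var]]] := cost_variation 0 0 (delta_mx i j).
  move/matrixP/(_ i j): gC; rewrite !mxE => <-; apply/esym.
  apply: (quadratic_variation_derive (c := c) del0) => h /var[_].
  by rewrite !scaler0 !addr0.
Qed.

End Controller.
End CostVariation.
End Stationarity.

(** * Riccati equations *)

Section Riccati.
Context {R : realType}.

(** The gain equation is kept in implicit form: then H satisfies the Riccati
   equation, and the dual filtering problem, whose weight W is zero, is also an
   instance. *)
Definition riccati_pair {n m} (A : 'M[R]_n) (B : 'M[R]_(n, m)) Q W
    (H : 'M[R]_n) (F : 'M[R]_(m, n)) : Prop :=
  [/\ psdmx H, H = Q + A^T *m H *m (A - B *m F),
      W *m F = B^T *m H *m (A - B *m F) & schur_stable (A - B *m F)].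

(** The difference of two solutions satisfies
   H1 - H2 = (A - B F1)^T (H1 - H2) (A - B F2), with both factors stable. *)
Lemma riccati_unique {n m} (A : 'M[R]_n) (B : 'M[R]_(n, m)) Q W H1 H2 F1 F2 :
    Q^T = Q -> W^T = W ->
    riccati_pair A B Q W H1 F1 -> riccati_pair A B Q W H2 F2 -> H1 = H2.
Proof.
move=> QT WT [[H1T _] H1E WF1 st1] [[H2T _] H2E WF2 st2].
have H1E' : H1 = Q + (A - B *m F1)^T *m H1 *m A.
  by rewrite -{1}H1T {1}H1E [(Q + _)^T]linearD/= QT !trmx_mul trmxK H1T mulmxA.
have WF1' : F1^T *m W = (A - B *m F1)^T *m H1 *m B.
  by rewrite -{1}WT -trmx_mul WF1 !trmx_mul trmxK H1T mulmxA.
apply/eqP; rewrite -subr_eq0; apply/eqP.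
apply: (stein_unique (schur_stableT st1) st2).
have -> : (A - B *m F1)^T *m (H1 - H2) *m (A - B *m F2) =
    ((A - B *m F1)^T *m H1 *m A - (A - B *m F1)^T *m H1 *m B *m F2) -
    (A^T *m H2 *m (A - B *m F2) - F1^T *m (B^T *m H2 *m (A - B *m F2))).
  rewrite [_ *m (H1 - H2)]mulmxBr mulmxBl; congr (_ - _).
    by rewrite mulmxBr !mulmxA.
  by rewrite [(A - B *m F1)^T]linearB/= trmx_mul !mulmxBl !mulmxA.
rewrite -WF1' -WF2 {1}H1E' {1}H2E.
by rewrite !mulmxA; apply/matrixP => i j; rewrite !mx_linE; ring.
Qed.

Lemma riccati_gain_unique {n m} (A : 'M[R]_n) (B : 'M[R]_(n, m)) Q W H F1 F2 :
    W + B^T *m H *m B \in unitmx ->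
    riccati_pair A B Q W H F1 -> riccati_pair A B Q W H F2 -> F1 = F2.
Proof.
move=> Gu [_ _ WF1 _] [_ _ WF2 _]; apply: (can_inj (mulKmx Gu)).
have gain F : W *m F = B^T *m H *m (A - B *m F) ->
    (W + B^T *m H *m B) *m F = B^T *m H *m A.
  by move=> WF; rewrite mulmxDl WF mulmxBr !mulmxA subrK.
by rewrite !gain.
Qed.

End Riccati.

(** A controller that runs a state observer in the coordinates xi = T x, with
   S = T^-1, feedback gain F = - CK T and observer gain L = S BK; so
   AK = T (A - B F - L C) S. H is the value matrix of the control problem and D
   the error covariance of the filter. The initial second moment X dictates the
   coordinates. *)
Definition observer_based {R : realType} {n m d : nat}
    (A : 'M[R]_n) (B : 'M[R]_(n, m)) (C : 'M[R]_(d, n)) (Q : 'M[R]_n) (W : 'M[R]_m)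
    (X : 'M[R]_(n + n)) (AK : 'M[R]_n) (BK : 'M[R]_(n, d)) (CK : 'M[R]_(m, n)) :
    Prop :=
  exists T S H D : 'M[R]_n,
  [/\ T *m S = 1%:M /\ S *m drsubmx X = ursubmx X,
      riccati_pair A B Q W H (- (CK *m T)),
      pdmx D,
      riccati_pair A^T C^T (ulsubmx X - S *m dlsubmx X)^T 0 D (S *m BK)^T &
      AK = T *m (A *m S + B *m CK) - BK *m C *m S].

(** * Stationary controllers are observers *)

Section StationaryStructure.
Context {R : realType} {n m d : nat}.
Variables (A : 'M[R]_n) (B : 'M[R]_(n, m)) (C : 'M[R]_(d, n)).
Variables (Q : 'M[R]_n) (W : 'M[R]_m).
Variables (AK : 'M[R]_n) (BK : 'M[R]_(n, d)) (CK : 'M[R]_(m, n)).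
Variables (P11 P12 P21 P22 S11 S12 S21 S22 X11 X12 X21 X22 : 'M[R]_n).
Local Notation M := (block_mx A (B *m CK) (BK *m C) AK).
Local Notation P := (block_mx P11 P12 P21 P22).
Local Notation Sg := (block_mx S11 S12 S21 S22).
Local Notation X := (block_mx X11 X12 X21 X22).
Hypothesis Ms : schur_stable M.
Hypotheses (Ppsd : psdmx P) (P22u : P22 \in unitmx).
Hypotheses (Spd : pdmx Sg) (S22u : S22 \in unitmx).
Hypothesis PE : P = stage_weight Q W CK + M^T *m P *m M.
Hypothesis SE : Sg = X + M *m Sg *m M^T.
Hypothesis stat : stationary_equations A B C W AK BK CK P Sg.

Variables (T S H D : 'M[R]_n).
Hypotheses (P21E : P21 = - (P22 *m T)) (S12E : S12 = S *m S22).
Hypotheses (HE : H = P11 + P12 *m T) (DE : D = S11 - S *m S21).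

(* The gradient in AK, freed of its invertible factors P22 and S22: the closed
   loop sends [S; 1] to a multiple of [1; T]. *)
Let Ta : BK *m C *m S + AK = T *m (A *m S + B *m CK).
Proof.
have [+ _ _] := stat; rewrite !mulmx_block block_mxKdr S12E P21E => N22.
have {N22} : P22 *m (BK *m C *m S + AK - T *m (A *m S + B *m CK)) *m S22 = 0.
  rewrite -[RHS]N22 !(mulmxDl, mulmxDr, mulNmx, mulmxN) !mulmxA.
  by apply/matrixP => i j; rewrite !mx_linE; ring.
move/(congr1 (mulmx^~ (invmx S22))); rewrite mulmxK// mul0mx.
move/(congr1 (mulmx (invmx P22))); rewrite mulKmx// mulmx0 => /eqP.
by rewrite subr_eq0 => /eqP.
Qed.

Let AKE : AK = T *m (A *m S + B *m CK) - BK *m C *m S.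
Proof. by rewrite -Ta addrC addKr. Qed.

(* The gradient in CK, after elimination of the second row by Ta. *)
Let WCK : W *m CK + B^T *m H *m (A *m S + B *m CK) = 0.
Proof.
have [_ _ +] := stat; rewrite !mulmx_block block_mxKur block_mxKdr S12E => N12.
have {N12} : (W *m CK + B^T *m H *m (A *m S + B *m CK)) *m S22 = 0.
  rewrite -[RHS]N12 AKE HE.
  rewrite !(mulmxDl, mulmxDr, mulNmx, mulmxN) !mulmxA.
  by apply/matrixP => i j; rewrite !mx_linE; ring.
by move/(congr1 (mulmx^~ (invmx S22))); rewrite mulmxK// mul0mx.
Qed.

(* The gradient in BK. *)
Let GDC : (BK *m C - T *m A) *m D *m C^T = 0.
Proof.
have [_ + _] := stat; rewrite !mulmx_block block_mxKdl P21E => N21.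
have {N21} : P22 *m ((BK *m C - T *m A) *m D *m C^T) = 0.
  rewrite -[RHS]N21 AKE DE.
  rewrite !(mulmxDl, mulmxDr, mulNmx, mulmxN) !mulmxA.
  by apply/matrixP => i j; rewrite !mx_linE; ring.
by move/(congr1 (mulmx (invmx P22))); rewrite mulKmx// mulmx0.
Qed.

(* The Lyapunov equation for P applied to [S; 1]; WCK kills the second row. *)
Let PV : P *m col_mx S 1%:M = col_mx (Q *m S + A^T *m H *m (A *m S + B *m CK)) 0.
Proof.
have MV : M *m col_mx S 1%:M =
    col_mx (A *m S + B *m CK) (T *m (A *m S + B *m CK)).
  by rewrite mul_block_col !mulmx1 Ta.
have PMV : P *m (M *m col_mx S 1%:M) = col_mx (H *m (A *m S + B *m CK)) 0.
  rewrite MV mul_block_col P21E; congr col_mx.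
    by rewrite HE [in RHS]mulmxDl mulmxA.
  by rewrite mulNmx mulmxA addNr.
rewrite {1}PE mulmxDl -!mulmxA PMV tr_block_mx !mul_block_col add_col_mx.
rewrite !mulmx0 !mul0mx !addr0 !mulmx1 add0r trmx_mul; congr col_mx.
by rewrite -!mulmxA -mulmxDr [B^T *m _]mulmxA WCK mulmx0.
Qed.

(* The second row of PV reads P22 (1 - T S) = 0. *)
Let TS : T *m S = 1%:M.
Proof.
have := PV; rewrite mul_block_col => /eq_col_mx[_]; rewrite mulmx1 P21E => PTS.
apply/esym/eqP; rewrite -subr_eq0 -(mulKmx P22u (_ - _)) mulmxBr mulmx1 mulmxA.
by rewrite addrC -mulNmx PTS mulmx0.
Qed.

Let ST : S *m T = 1%:M.
Proof. exact: mulmx1C TS. Qed.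

Let Fcl : A - B *m - (CK *m T) = (A *m S + B *m CK) *m T.
Proof. by rewrite mulmxN opprK mulmxDl -mulmxA ST mulmx1 mulmxA. Qed.

Let HS : H *m S = P11 *m S + P12.
Proof. by rewrite HE mulmxDl -mulmxA TS mulmx1. Qed.

(** The first row of PV is the Riccati equation times S. The closed loop maps
   [1; T] to [1; T] (A - B F), whence the stability. *)
Lemma stationary_control_riccati : riccati_pair A B Q W H (- (CK *m T)).
Proof.
have PV' : P *m col_mx 1%:M T = col_mx H 0.
  by rewrite mul_block_col !mulmx1 P21E addNr HE.
split.
- have -> : H = (col_mx 1%:M T)^T *m P *m col_mx 1%:M T.
    by rewrite -mulmxA PV' tr_col_mx mul_row_col mulmx0 addr0 trmx1 mul1mx.
  exact: psdmx_congr.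
- have := PV; rewrite mul_block_col => /eq_col_mx[+ _]; rewrite mulmx1 -HS.
  move/(congr1 (mulmx^~ T)); rewrite mulmxDl -!mulmxA ST !mulmx1 => {1}->.
  by rewrite Fcl !mulmxA.
- rewrite Fcl mulmxN !mulmxA -mulNmx; congr (_ *m T).
  by apply/esym/eqP; rewrite -addr_eq0 addrC WCK.
- apply: (@schur_stable_read _ _ _ M _ (row_mx 1%:M 0) (col_mx 1%:M T)) => // t.
  have MV t' : M ^+ t' *m col_mx 1%:M T =
      col_mx 1%:M T *m (A - B *m - (CK *m T)) ^+ t'.
    elim: t' => [|t' IH]; first by rewrite !expr0 mul1mx mulmx1.
    rewrite exprS -mulmxA IH mulmxA exprS [RHS]mulmxA; congr (_ *m _).
    rewrite Fcl mul_block_col mul_col_mx mul1mx !mulmx1; congr col_mx.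
      by rewrite mulmxDl -[A *m S *m T]mulmxA ST mulmx1.
    by rewrite mulmxA -Ta mulmxDl -[BK *m C *m S *m T]mulmxA ST mulmx1.
  by rewrite -mulmxA MV mulmxA mul_row_col mul1mx mul0mx addr0 mul1mx.
Qed.

(* The Lyapunov equation for Sg multiplied on the left by [-T 1]: the second
   column fixes the coordinates, the first is the filtering equation. *)
Let UX : T *m X12 = X22 /\
  D = X11 - S *m X21 + (A - S *m BK *m C) *m D *m A^T.
Proof.
pose U : 'M[R]_(n, n + n) := row_mx (- T) 1%:M.
pose G := BK *m C - T *m A.
have UM : U *m M = row_mx G (- (G *m S)).
  rewrite mul_row_block !mul1mx AKE /G; congr row_mx; first by rewrite mulNmx addrC.
  rewrite !(mulmxDl, mulmxDr, mulNmx, mulmxN) !mulmxA.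
  by apply/matrixP => i j; rewrite !mx_linE; ring.
have UMS : U *m M *m Sg = row_mx (G *m D) 0.
  rewrite UM mul_row_block S12E; congr row_mx.
    by rewrite DE mulmxBr !mulmxA mulNmx.
  by rewrite !mulmxA mulNmx addrN.
have := SE => /(congr1 (mulmx U)).
rewrite mulmxDr !mulmxA UMS tr_block_mx !mul_row_block add_row_mx.
rewrite !mul0mx !addr0 !mul1mx trmx_mul => /eq_row_mx[U1 U2].
split.
  move: U2; rewrite S12E mulNmx mulmxA TS mul1mx addNr mulmxA GDC mul0mx addr0.
  by move/esym/eqP; rewrite mulNmx addrC subr_eq0 => /eqP.
rewrite {1}DE; move: U1 => /(congr1 (mulmx (- S))).
rewrite !mulmxDr !mulNmx !mulmxN !mulmxA ST !mul1mx opprK => ->.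
rewrite !opprK; congr (_ + _); rewrite -!mulNmx; congr (_ *m _ *m _).
by rewrite /G !mulNmx mulmxBr !mulmxA ST mul1mx opprB.
Qed.

(** D is the Schur complement of S22 in Sg. *)
Lemma stationary_error_covariance_pd : pdmx D.
Proof.
have -> : D = (col_mx 1%:M (- S^T))^T *m Sg *m col_mx 1%:M (- S^T).
  rewrite tr_col_mx trmx1 linearN/= trmxK mul_row_block mul_row_col !mul1mx.
  by rewrite S12E DE !mulNmx addrN mul0mx addr0 mulmx1.
apply: pdmx_congr Spd _ => x; rewrite mul_col_mx mul1mx.
by rewrite -[0]vsubmxK => /eq_col_mx[-> _]; rewrite linear0.
Qed.

(** Dually, [1 -S] intertwines the closed loop with A - L C, whence the
   stability. *)
Lemma stationary_filter_riccati :
  riccati_pair A^T C^T (X11 - S *m X21)^T 0 D (S *m BK)^T.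
Proof.
have Dpd := stationary_error_covariance_pd; have [DT _] := Dpd.
have [_ DX] := UX.
have clE : A^T - C^T *m (S *m BK)^T = (A - S *m BK *m C)^T.
  by rewrite -trmx_mul -linearB.
have AL0 : (A - S *m BK *m C) *m D *m C^T = 0.
  have -> : A - S *m BK *m C = - S *m (BK *m C - T *m A).
    by rewrite mulmxBr !mulNmx !mulmxA ST mul1mx opprK addrC.
  by rewrite -!mulmxA [_ *m (D *m _)]mulmxA GDC mulmx0.
split; first exact: pdmx_psd.
- rewrite clE -{1}DT {1}DX [(X11 - _ + _)^T]linearD/=.
  by rewrite [(_ *m A^T)^T]trmx_mul [(_ *m D)^T]trmx_mul DT mulmxA.
- have := congr1 trmx AL0; rewrite clE mul0mx trmx0 => /esym ->.
  by rewrite [(_ *m C^T)^T]trmx_mul [(_ *m D)^T]trmx_mul DT mulmxA.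
- rewrite clE; apply: schur_stableT.
  apply: (@schur_stable_read _ _ _ M _ (row_mx 1%:M (- S)) (col_mx 1%:M 0)) => // t.
  have UM t' : row_mx 1%:M (- S) *m M ^+ t' =
      (A - S *m BK *m C) ^+ t' *m row_mx 1%:M (- S).
    elim: t' => [|t' IH]; first by rewrite !expr0 mul1mx mulmx1.
    rewrite exprSr mulmxA IH exprSr -[LHS]mulmxA -[RHS]mulmxA; congr (_ *m _).
    rewrite mul_row_block mul_mx_row !mul1mx mulmx1 AKE; congr row_mx.
      by rewrite mulNmx mulmxA.
    rewrite !(mulmxDl, mulmxDr, mulNmx, mulmxN) !mulmxA ST !mul1mx.
    by apply/matrixP => i j; rewrite !mx_linE; ring.
  by rewrite UM -[RHS]mulmxA mul_row_col mulmx0 addr0 !mulmx1.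
Qed.

Lemma stationary_blocks_observer_based : observer_based A B C Q W X AK BK CK.
Proof.
exists T, S, H, D; split.
- split=> //; rewrite block_mxKdr block_mxKur -UX.1 mulmxA ST mul1mx //.
- exact: stationary_control_riccati.
- exact: stationary_error_covariance_pd.
- by rewrite block_mxKul block_mxKdl; exact: stationary_filter_riccati.
- exact: AKE.
Qed.

End StationaryStructure.

(** * Uniqueness of the observable stationary controller *)

Section Uniqueness.
Context {R : realType} {n m d : nat}.
Variables (A : 'M[R]_n) (B : 'M[R]_(n, m)) (C : 'M[R]_(d, n)).
Variables (Q : 'M[R]_n) (W : 'M[R]_m).
Hypotheses (Qpsd : psdmx Q) (Wpd : pdmx W).

Lemma pdmx_drsub {p q} (M : 'M[R]_(p + q)) : pdmx M -> pdmx (drsubmx M).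
Proof.
move=> Mpd.
have -> : drsubmx M = (col_mx 0 1%:M)^T *m M *m col_mx 0 1%:M.
  rewrite -[M in RHS]submxK tr_col_mx mul_row_block mul_row_col.
  by rewrite trmx0 trmx1 !mul0mx !mul1mx mulmx0 mulmx1 !add0r.
apply: pdmx_congr Mpd _ => x; rewrite mul_col_mx mul1mx mul0mx.
by rewrite -[0 in RHS]vsubmxK => /eq_col_mx[_ ->]; rewrite linear0.
Qed.

Lemma sym_dlsub {p q} (M : 'M[R]_(p + q)) : M^T = M -> dlsubmx M = (ursubmx M)^T.
Proof. by move=> MT; rewrite trmx_ursub MT. Qed.

Lemma observable_eq0 {p q} (G : 'M[R]_(q, p)) (N : 'M[R]_p) (x : nat -> 'cV[R]_p) :
  observable G N -> (forall t, x t.+1 = N *m x t) -> (forall t, G *m x t = 0) ->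
  x 0 = 0.
Proof.
move=> obs xS Gx; apply: obs => t.
have -> : iter t (mulmx N) (x 0) = x t.
  by elim: t => // t IH; rewrite iterS IH xS.
have -> : iter t (mulmx N) (0 : 'cV[R]_p) = 0.
  by elim: t => // t IH; rewrite iterS IH mulmx0.
by rewrite Gx mulmx0.
Qed.

(** Zero cost forces x_t = A^t x_0 with Qhalf x_t = 0, hence x = 0; then the
   controller runs freely with CK xi_t = 0, hence xi = 0. *)
Lemma lyapunov_pd Qhalf AK BK CK (P : 'M[R]_(n + n)) :
    let M := block_mx A (B *m CK) (BK *m C) AK in
    is_psd_sqrt Q Qhalf -> observable Qhalf A -> observable CK AK ->
    schur_stable M -> P = stage_weight Q W CK + M^T *m P *m M ->
  pdmx P.
Proof.
move=> M Qsqrt Qobs Kobs Ms PE.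
have Ypsd := stage_weight_psd CK Qpsd Wpd.
split; first exact: lyapunov_sym Ms PE Ypsd.1.
move=> z; apply: contraNT; rewrite -leNgt => Pz.
have Yz := lyapunov_quad_eq0 Ms PE Ypsd Pz.
pose x t := usubmx (M ^+ t *m z); pose xi t := dsubmx (M ^+ t *m z).
have MtS t : M ^+ t.+1 *m z = col_mx (A *m x t + B *m (CK *m xi t))
    (BK *m C *m x t + AK *m xi t).
  rewrite exprS -[LHS]mulmxA -[M ^+ t *m z in LHS]vsubmxK -/(x t) -/(xi t).
  by rewrite mul_block_col !mulmxA.
have Qx t : Qhalf *m x t = 0 /\ CK *m xi t = 0.
  have [_ Q0] := Qpsd; have [_ W0] := pdmx_psd Wpd.
  have := Yz t; rewrite quad_stage_weight -/(x t) -/(xi t) => QW0.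
  have Q0t := Q0 (x t); have W0t := W0 (CK *m xi t).
  split; first by apply: psd_sqrt_eq0 Qsqrt _; lra.
  by apply: (pdmx_eq0 Wpd); lra.
have xS t : x t.+1 = A *m x t.
  by rewrite {1}/x MtS col_mxKu (Qx t).2 mulmx0 addr0.
have x0 : x 0 = 0 by apply: observable_eq0 Qobs xS (fun t => (Qx t).1).
have xt t : x t = 0 by elim: t => // t IH; rewrite xS IH mulmx0.
have xi0 : xi 0 = 0.
  apply: observable_eq0 Kobs _ (fun t => (Qx t).2) => t.
  by rewrite {1}/xi MtS col_mxKd xt mulmx0 add0r.
have -> : z = M ^+ 0 *m z by rewrite expr0 mul1mx.
by rewrite -[M ^+ 0 *m z]vsubmxK -/(x 0) -/(xi 0) x0 xi0 col_mx0.
Qed.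

Lemma stationary_observer_based X AK BK CK P Sg :
    let M := block_mx A (B *m CK) (BK *m C) AK in
    schur_stable M -> pdmx P -> pdmx X ->
    P = stage_weight Q W CK + M^T *m P *m M -> Sg = X + M *m Sg *m M^T ->
    stationary_equations A B C W AK BK CK P Sg ->
  observer_based A B C Q W X AK BK CK.
Proof.
move=> M Ms Ppd Xpd PE SE stat.
have Spd : pdmx Sg.
  rewrite SE; apply: pdmx_addr => //.
  rewrite -[M in M *m Sg]trmxK; apply: psdmx_congr.
  apply: (@lyapunov_psd _ _ M^T X) (pdmx_psd Xpd); first exact: schur_stableT.
  by rewrite trmxK.
have P22u := pdmx_unit (pdmx_drsub Ppd).
have S22u := pdmx_unit (pdmx_drsub Spd).
pose T := - (invmx (drsubmx P) *m dlsubmx P).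
pose S := ursubmx Sg *m invmx (drsubmx Sg).
have P21E : dlsubmx P = - (drsubmx P *m T) by rewrite mulmxN opprK mulKVmx.
have S12E : ursubmx Sg = S *m drsubmx Sg by rewrite mulmxKV.
have Ppsd := pdmx_psd Ppd.
rewrite -[P]submxK in Ppsd PE stat; rewrite -[Sg]submxK in Spd SE stat.
rewrite -[X]submxK in SE *.
exact: (stationary_blocks_observer_based Ms Ppsd P22u Spd S22u PE SE stat P21E S12E).
Qed.

(** The data are determined one after the other: S by X, then T, H, F, D and
   L. *)
Lemma observer_based_unique X AK1 BK1 CK1 AK2 BK2 CK2 : row_free C -> pdmx X ->
    observer_based A B C Q W X AK1 BK1 CK1 -> observer_based A B C Q W X AK2 BK2 CK2 ->
  controller AK1 BK1 CK1 = controller AK2 BK2 CK2.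
Proof.
move=> Cfree Xpd [T1 [S1 [H1 [D1 [[TS1 SX1] HF1 Dpd1 DL1 AK1E]]]]].
move=> [T2 [S2 [H2 [D2 [[TS2 SX2] HF2 _ DL2 AK2E]]]]].
have [XT _] := Xpd; have [X22T _] := pdmx_drsub Xpd.
have X22u := pdmx_unit (pdmx_drsub Xpd).
have SE : S2 = S1 by apply: (can_inj (mulmxK X22u)); rewrite SX1 SX2.
subst S2; have ST1 := mulmx1C TS1.
have TE : T2 = T1 by rewrite -[T1]mul1mx -TS2 -mulmxA ST1 mulmx1.
subst T2.
have HE : H2 = H1.
  by apply: riccati_unique HF2 HF1; [exact: Qpsd.1|exact: Wpd.1].
subst H2.
have Gu : W + B^T *m H1 *m B \in unitmx.
  by have [Hpsd _ _ _] := HF1; apply/pdmx_unit/pdmx_addr/psdmx_congr.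
have FE := riccati_gain_unique Gu HF1 HF2.
have CKE : CK2 = CK1.
  rewrite -[CK1]mulmx1 -[CK2]mulmx1 -TS1 !mulmxA.
  by congr (_ *m _); apply/esym/oppr_inj.
have XeT : (ulsubmx X - S1 *m dlsubmx X)^T^T = (ulsubmx X - S1 *m dlsubmx X)^T.
  congr trmx; rewrite sym_dlsub// -SX1 linearB/= !trmx_mul !trmxK.
  by rewrite X22T mulmxA trmx_ulsub XT.
have DE : D2 = D1 by apply: riccati_unique XeT _ DL2 DL1; rewrite trmx0.
subst D2.
have Lu : 0 + C^T^T *m D1 *m C^T \in unitmx.
  rewrite add0r; apply/pdmx_unit/(pdmx_congr Dpd1) => x Cx.
  apply: trmx_inj; apply: (row_free_inj Cfree).
  by rewrite trmx0 mul0mx -[C in LHS]trmxK -trmx_mul Cx trmx0.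
have LE := trmx_inj (riccati_gain_unique Lu DL1 DL2).
have BKE : BK2 = BK1 by rewrite -[BK1]mul1mx -[BK2]mul1mx -TS1 -!mulmxA LE.
by rewrite AK1E AK2E CKE BKE.
Qed.

End Uniqueness.

Theorem corollary1 (R : realType) (n m d : nat)
    (A : 'M[R]_n) (B : 'M[R]_(n, m)) (C : 'M[R]_(d, n))
    (Q : 'M[R]_n) (W : 'M[R]_m)
    (hQ : psdmx Q) (hW : pdmx W)
    (disp : measure_display) (Omega : measurableType disp)
    (P : probability Omega R)
    (z0 : 'I_(n + n) -> {RV P >-> R})
    (hz0 : forall i, (z0 i : Omega -> R) \in Lfun P 2%:E)
    (hC : row_free C)
    (hX : pdmx (second_moment z0))
    (hAB : controllable A B)
    (hCA : observable C A)
    (Qhalf : 'M[R]_n) (hQhalf : is_psd_sqrt Q Qhalf)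
    (hQA : observable Qhalf A)
    (hopt : exists Kopt : 'M[R]_(m + n, d + n),
       globally_optimal A B C (cost A B C Q W z0) Kopt /\
       observable_controllers Kopt)
    (K_ : nat -> 'M[R]_(m + n, d + n)) (alpha : nat -> R)
    (hiter : forall i,
       K_ i.+1 = K_ i - alpha i *: policy_gradient (cost A B C Q W z0) (K_ i))
    (halpha_gt0 : forall i, 0 < alpha i)
    (hK_ : forall i, stabilizing A B C (K_ i))
    (halpha_inf : 0 < inf (range alpha))
    (Kstar : 'M[R]_(m + n, d + n))
    (hlim : K_ @ \oo --> Kstar)
    (hstat : stationary_points A B C (cost A B C Q W z0) Kstar)
    (hobs : observable_controllers Kstar) :
  forall K : 'M[R]_(m + n, d + n), stabilizing A B C K ->
    cost A B C Q W z0 Kstar <= cost A B C Q W z0 K.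
Proof.
have [Kopt [opt [Kopt0 Kopt_obs]]] := hopt.
have [[_ rho_opt] opt_min] := opt.
have [[_ rho_star] grad0] := hstat; have [Kstar0 Kstar_obs] := hobs.
have observer_of K : is_controller K -> observable (ctrlC K) (ctrlA K) ->
    spectral_radius (closed_loop A B C K) < 1 ->
    globally_optimal A B C (cost A B C Q W z0) K \/
      policy_gradient (cost A B C Q W z0) K = 0 ->
    observer_based A B C Q W (second_moment z0) (ctrlA K) (ctrlB K) (ctrlC K).
  move=> K0 Kobs rho crit; rewrite (controller_eta K0) in rho crit.
  rewrite closed_loop_controller in rho.
  have Ms := spectral_radius_schur rho; have MsT := schur_stableT Ms.
  have [PK PKE] := stein_exists (stage_weight Q W (ctrlC K)) MsT Ms.
  have [SK SKE] := stein_exists (second_moment z0) Ms MsT.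
  apply: (stationary_observer_based Ms _ hX PKE SKE).
    exact: (lyapunov_pd hQ hW hQhalf hQA Kobs Ms PKE).
  case: crit => crit.
    exact: (stationary_equations_optimal hQ hW hz0 hX Ms PKE SKE crit).
  exact: (stationary_equations_gradient hQ hW hz0 hX Ms PKE SKE crit).
suff -> : Kstar = Kopt by [].
rewrite (controller_eta Kstar0) (controller_eta Kopt0).
apply: (observer_based_unique hQ hW hC hX); apply: observer_of => //.
- by right.
- by left.
Qed.
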